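(* Let $\rho,l,k_0,c_0,\delta,p>0$, let $\theta_0>0$, $\theta_0>\theta_f$, and put $a=\sqrt{k_0/(\rho c_0)}$ and $\mathrm{Ste}=c_0(\theta_0-\theta_f)/l$. Let $\beta=\beta(\eta)\ge 0$ be a function such that $\beta$ is integrable on $(0,\epsilon)$ for all $\epsilon>0$ and $\beta(\eta)\exp(\eta^2)$ is integrable on $(M,+\infty)$ for all $M>0$. Consider the one-phase Stefan problem for the unknowns $\theta=\theta(x,t)$ and $s=s(t)$: $$\rho c(\theta)\frac{\partial\theta}{\partial t}=\frac{\partial}{\partial x}\Big(k(\theta)\frac{\partial\theta}{\partial x}\Big)-\frac{\rho l}{t}\,\beta\Big(\frac{x}{2a\sqrt t}\Big),\quad 0<x<s(t),\ t>0,$$ $$\theta(0,t)=\theta_0,\qquad \theta(s(t),t)=\theta_f,\qquad k_0\frac{\partial\theta}{\partial x}(s(t),t)=-\rho l\,\dot s(t)\quad (t>0),\qquad s(0)=0,$$ where $$k(\theta)=k_0\Big(1+\delta\big(\tfrac{\theta-\theta_f}{\theta_0-\theta_f}\big)^p\Big),\qquad c(\theta)=c_0\Big(1+\delta\big(\tfrac{\theta-\theta_f}{\theta_0-\theta_f}\big)^p\Big).$$ Then this problem has a unique similarity type solution, given by $$\theta(x,t)=(\theta_0-\theta_f)\,y\Big(\frac{x}{2a\sqrt t}\Big)+\theta_f,\quad 0<x<s(t),\ t>0,\qquad s(t)=2a\lambda\sqrt t,\quad t>0,$$ where $(y,\lambda)$, with $\lambda>0$, $y\in C^\infty[0,\lambda]$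 and $y\ge 0$, is the unique solution to the following functional problem: $\lambda$ is a solution of the equation $$\frac{\sqrt\pi}{\mathrm{Ste}}\,x\,\mathrm{erf}(x)\exp(x^2)+\frac{2\sqrt\pi}{\mathrm{Ste}}\int_0^x\exp(\xi^2)\,\mathrm{erf}(\xi)\,\beta(\xi)\,d\xi=1+\frac{\delta}{p+1},\quad x>0,$$ and, for all $0\le\eta\le\lambda$, $$y(\eta)\Big(1+\frac{\delta}{p+1}y^p(\eta)\Big)=1+\frac{\delta}{p+1}-\frac{\sqrt\pi\,\mathrm{erf}(\eta)}{\mathrm{Ste}}\Big(2\int_0^\lambda\beta(\xi)\exp(\xi^2)\,d\xi+\lambda\exp(\lambda^2)\Big)+\frac{2\sqrt\pi}{\mathrm{Ste}}\int_0^\eta\beta(\xi)\exp(\xi^2)\big(\mathrm{erf}(\eta)-\mathrm{erf}(\xi)\big)\,d\xi .$$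
   Context: $\mathrm{erf}(x)=\frac{2}{\sqrt\pi}\int_0^x e^{-z^2}\,dz$. A similarity type solution is a solution $(\theta,s)$ of the Stefan problem of the form $s(t)=2a\lambda\sqrt t$, $\theta(x,t)=(\theta_0-\theta_f)\,y(x/(2a\sqrt t))+\theta_f$, with $\lambda>0$, $y\in C^\infty[0,\lambda]$ and $y\ge 0$.
   Formalization: As y fails to be C^∞ at λ for β=0, p=1/2 (and for rough β), y is only C^1 on [0,λ], and C^∞ on segments where β is C^∞ (ending before λ unless p is an integer); the PDE holds where β is continuous and a.e. in x, with locally absolutely continuous flux. *)

(* Defs.v *)
From HB Require Import structures.
From mathcomp Require Import all_boot all_order all_algebra.
From mathcomp Require Import all_classical all_reals all_analysis.

Set Implicit Arguments.
Unset Strict Implicit.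
Unset Printing Implicit Defensive.

Import Order.TTheory GRing.Theory Num.Theory.
Import numFieldNormedType.Exports.

Local Open Scope ring_scope.
Local Open Scope classical_set_scope.

Definition erf (R : realType) (x : R) : R :=
  2 / Num.sqrt pi *
  (if 0 <= x then \int[lebesgue_measure]_(z in `[0, x]) expR (- z ^+ 2)
   else - \int[lebesgue_measure]_(z in `[x, 0]) expR (- z ^+ 2)).

(* One-sided at an end point of an interval D, two-sided in its interior. *)
Definition has_derivative_within (R : realType) (D : set R) (f : R -> R)
    (x l : R) : Prop :=
  (fun z => (f z - f x) / (z - x)) @ within D x^' --> l.

Definition C1_on (R : realType) (D : set R) (f : R -> R) : Prop :=
  exists df : R -> R,
    (forall x, D x -> has_derivative_within D f x (df x)) /\
    {within D, continuous df}.

(* f is of class C^oo on the interval D: d n is the n-th derivative of f. *)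
Definition Coo_on (R : realType) (D : set R) (f : R -> R) : Prop :=
  exists d : nat -> R -> R,
    (forall x, D x -> d 0%N x = f x) /\
    (forall n x, D x -> has_derivative_within D (d n) x (d n.+1 x)).

(* Absolute continuity on [u, v], as being an indefinite Lebesgue integral. *)
Definition abs_continuous_on (R : realType) (u v : R) (f : R -> R) : Prop :=
  exists g : R -> R,
    lebesgue_measure.-integrable `[u, v] (EFin \o g) /\
    (forall x, u <= x <= v ->
       f x - f u = \int[lebesgue_measure]_(z in `[u, x]) g z).

(* The k(theta) and c(theta) of the problem, with w = k0 or w = c0. *)
Definition thermal_coefficient (R : realType) (w delta p theta0 thetaf th : R)
    : R :=
  w * (1 + delta * ((th - thetaf) / (theta0 - thetaf)) `^ p).

Definition heat_flux (R : realType) (k0 delta p theta0 thetaf : R)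
    (theta : R -> R -> R) (t x : R) : R :=
  thermal_coefficient k0 delta p theta0 thetaf (theta x t) *
  derive1 (fun z => theta z t) x.

Definition heat_equation_at (R : realType)
    (rho l k0 c0 delta p theta0 thetaf a : R) (beta : R -> R)
    (theta : R -> R -> R) (x t : R) : Prop :=
  derivable (heat_flux k0 delta p theta0 thetaf theta t) x 1 /\
  rho * thermal_coefficient c0 delta p theta0 thetaf (theta x t) *
    derive1 (fun r => theta x r) t =
  derive1 (heat_flux k0 delta p theta0 thetaf theta t) x
    - rho * l / t * beta (x / (2 * a * Num.sqrt t)).

(* As beta is only integrable, the heat equation cannot be required at every
   point: it holds at almost every x and, classically, at every x where the
   source is continuous.  For theta of
   class C^1 and beta continuous, the latter is the heat equation everywhere and
   implies absolute continuity of the flux; for a general beta that requirement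
   excludes singular (Cantor-like) parts, which an equation holding a.e. does
   not see. *)
Definition stefan_solution (R : realType)
    (rho l k0 c0 delta p theta0 thetaf a : R) (beta : R -> R)
    (theta : R -> R -> R) (s : R -> R) : Prop :=
  s 0 = 0 /\
  forall t, 0 < t ->
    [/\ forall x, 0 < x < s t ->
          derivable (fun z => theta z t) x 1 /\
          derivable (fun r => theta x r) t 1,
        (forall x, 0 < x < s t ->
          {for x / (2 * a * Num.sqrt t), continuous beta} ->
          heat_equation_at rho l k0 c0 delta p theta0 thetaf a beta theta x t)
        /\
        (\forall x \ae lebesgue_measure, 0 < x < s t ->
          heat_equation_at rho l k0 c0 delta p theta0 thetaf a beta theta x t)
        /\
        (forall u v, 0 < u -> u < v -> v < s t ->
          abs_continuous_on u v
            (heat_flux k0 delta p theta0 thetaf theta t)),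
        theta 0 t = theta0 /\ theta (s t) t = thetaf &
        derivable s t 1 /\
        exists2 thetax : R,
          has_derivative_within `[0, s t] (fun z => theta z t) (s t) thetax &
          k0 * thetax = - (rho * l * derive1 s t)].

(* The requirement lambda > 0, y in C^oo[0, lambda], y >= 0.
   Since G = y + delta / (p + 1) * y^(p+1) satisfies
   G'' + 2 eta G' = 4 beta / Ste and y vanishes at lambda, y is not smoother
   than beta allows, nor smooth up to lambda when p is not an integer.  So y is
   required to be C^1 on [0, lambda], and C^oo on every segment where these two
   obstructions are absent.  When beta is C^oo on [0, lambda] and p is an
   integer, this is exactly y in C^oo[0, lambda]; when beta is C^oo on
   [0, lambda] and p is not an integer, it includes y in C^oo[0, lambda). *)
Definition admissible_profile (R : realType) (p : R) (beta : R -> R)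
    (lambda : R) (y : R -> R) : Prop :=
  [/\ 0 < lambda,
      forall eta, 0 <= eta <= lambda -> 0 <= y eta,
      C1_on `[0, lambda] y &
      forall u v, 0 <= u -> u < v -> v <= lambda ->
        Coo_on `[u, v] beta ->
        v < lambda \/ (exists n : nat, p = n%:R) ->
        Coo_on `[u, v] y].

Definition similarity_form (R : realType) (theta0 thetaf a lambda : R)
    (y : R -> R) (theta : R -> R -> R) (s : R -> R) : Prop :=
  forall t, 0 < t ->
    s t = 2 * a * lambda * Num.sqrt t /\
    (forall x, 0 <= x <= s t ->
      theta x t =
      (theta0 - thetaf) * y (x / (2 * a * Num.sqrt t)) + thetaf).

Definition similarity_solution (R : realType)
    (rho l k0 c0 delta p theta0 thetaf a : R) (beta : R -> R)
    (theta : R -> R -> R) (s : R -> R) : Prop :=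
  stefan_solution rho l k0 c0 delta p theta0 thetaf a beta theta s /\
  exists lambda y, admissible_profile p beta lambda y /\
    similarity_form theta0 thetaf a lambda y theta s.

Definition front_equation (R : realType) (delta p Ste : R) (beta : R -> R)
    (x : R) : Prop :=
  Num.sqrt pi / Ste * x * erf x * expR (x ^+ 2) +
  2 * Num.sqrt pi / Ste *
    (\int[lebesgue_measure]_(xi in `[0, x])
       (expR (xi ^+ 2) * erf xi * beta xi))
  = 1 + delta / (p + 1).

Definition profile_equation (R : realType) (delta p Ste : R) (beta : R -> R)
    (lambda : R) (y : R -> R) (eta : R) : Prop :=
  y eta * (1 + delta / (p + 1) * y eta `^ p) =
  1 + delta / (p + 1)
  - Num.sqrt pi * erf eta / Ste *
    (2 * (\int[lebesgue_measure]_(xi in `[0, lambda])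
            (beta xi * expR (xi ^+ 2)))
     + lambda * expR (lambda ^+ 2))
  + 2 * Num.sqrt pi / Ste *
    (\int[lebesgue_measure]_(xi in `[0, eta])
       (beta xi * expR (xi ^+ 2) * (erf eta - erf xi))).

Definition functional_problem (R : realType) (delta p Ste : R)
    (beta : R -> R) (lambda : R) (y : R -> R) : Prop :=
  [/\ admissible_profile p beta lambda y,
      front_equation delta p Ste beta lambda &
      forall eta, 0 <= eta <= lambda ->
        profile_equation delta p Ste beta lambda y eta].

(* Main.v *)
Require Import Defs.
From HB Require Import structures.
From mathcomp Require Import all_boot all_order all_algebra.
From mathcomp Require Import all_classical all_reals all_analysis.
From mathcomp Require Import ring lra.

Set Implicit Arguments.
Unset Strict Implicit.
Unset Printing Implicit Defensive.

Import Order.TTheory GRing.Theory Num.Theory.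
Import numFieldNormedType.Exports.

Local Open Scope ring_scope.
Local Open Scope classical_set_scope.

(* In the similarity variable eta = x / (2 a sqrt t), Kirchhoff's transform
   G = y + delta / (p + 1) y^(p+1) of the profile solves the linear equation
   G'' + 2 eta G' = 4 beta / Ste.  The integrating factor exp (eta^2) and the
   Stefan condition G'(lambda) = - 2 lambda / Ste determine G', and integrating
   from G(0) = 1 + delta / (p + 1) gives the profile equation; its value at
   lambda vanishes exactly when the front equation holds.  The front equation
   has one positive root because its left-hand side is continuous, increasing,
   null at 0 and unbounded, and y is recovered from G because Kirchhoff's
   transform is an expanding bijection of [0, +oo[.

   As beta is only integrable, integrations by parts are replaced by the fact
   that E(x) int_0^x b - int_0^x b E has derivative E'(x) int_0^x b whenever E
   is C^1 and b integrable.  Conversely, a similarity solution is read off at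
   the time at which 2 a sqrt t = 1. *)


(** * Derivatives within a set *)

(** The constants come from inserting the similarity form. As [k0 = a^2 rho c0], dividing the heat
    equation by [rho c0 (theta0 - thetaf) / (4 t)] leaves the coefficient
    [4 l / (c0 (theta0 - thetaf)) = 4 / Ste] before [beta]. The Stefan condition becomes
    [y'(lambda) = - 2 lambda / Ste], and [G' = y'] there because [y] vanishes at [lambda]. Two
    obstacles shape the proof. The profile lives on a closed segment and vanishes at its end, where
    [u^p] need not be differentiable and the front condition is one-sided, so the calculus is
    developed for derivatives within a set. Moreover [G''] exists only almost everywhere, which does
    not determine the increments of [G']. The equation is therefore used in integrated form:
    absolute continuity of the flux provides it in the interior, and continuity of [y'] carries the
    outcome up to both ends. *)

Lemma cvg_withinP (R : realType) (D : set R) (f : R -> R) (x l : R) :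
  f @ within D (nbhs x) --> l <->
  forall e, 0 < e -> exists2 d, 0 < d &
    forall z, D z -> `|z - x| < d -> `|f z - l| <= e.
Proof.
split=> [/cvgrPdist_le fl e e0|fl].
  have /nbhs_ballP[d /= d0 dfl] := fl e e0.
  exists d => // z Dz zx; rewrite distrC; apply: (dfl z) => //.
  by rewrite /ball /= distrC.
apply/cvgrPdist_le => e e0; have [d d0 dfl] := fl e e0.
apply/nbhs_ballP; exists d => //= z zx Dz.
by rewrite distrC dfl// distrC.
Qed.

(** Multiplying the error by [|z - x|] makes the estimate trivial at [z = x], so the puncture in
    [x^'] and the division both disappear. *)
Lemma derivative_withinP (R : realType) (D : set R) (f : R -> R) (x l : R) :
  has_derivative_within D f x l <->
  forall e, 0 < e -> exists2 d, 0 < d & forall z, D z -> `|z - x| < d ->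
    `|f z - f x - l * (z - x)| <= e * `|z - x|.
Proof.
split=> [/cvgrPdist_le fl e e0|fl].
  have /nbhs_ballP[d /= d0 dfl] := fl e e0.
  exists d => // z Dz zx; have [->|zNx] := eqVneq z x.
    by rewrite !subrr mulr0 subr0 normr0 mulr0.
  have zx0 : z - x != 0 by rewrite subr_eq0.
  have -> : f z - f x - l * (z - x) = ((f z - f x) / (z - x) - l) * (z - x).
    by rewrite mulrBl divfK.
  rewrite normrM ler_wpM2r// distrC; apply: (dfl z) => //.
  by rewrite /ball /= distrC.
apply/cvgrPdist_le => e e0; have [d d0 dfl] := fl e e0.
apply/nbhs_ballP; exists d => //= z zx zNx Dz.
have zx0 : z - x != 0 by rewrite subr_eq0.
have zx1 : 0 < `|z - x| by rewrite normr_gt0.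
rewrite -(ler_pM2r zx1) distrC -normrM mulrBl divfK//.
by rewrite dfl// distrC.
Qed.

Section derivative_within.
Context {R : realType}.
Implicit Types (D E : set R) (f g : R -> R).

Lemma cvg_within_comp D E f g (x l : R) : (forall z, D z -> E (f z)) ->
  f @ within D (nbhs x) --> f x -> g @ within E (nbhs (f x)) --> l ->
  (g \o f) @ within D (nbhs x) --> l.
Proof.
move=> fDE fx gl; apply/cvg_withinP => e e0.
have [d d0 dg] := (cvg_withinP _ _ _ _).1 gl e e0.
have d20 : 0 < d / 2 by rewrite divr_gt0.
have [d' d'0 df] := (cvg_withinP _ _ _ _).1 fx _ d20.
exists d' => // z Dz zx; apply: dg; first exact: fDE.
by rewrite (le_lt_trans (df z Dz zx))// ltr_pdivrMr// ltr_pMr// ltr1n.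
Qed.

(** The factor [phi] absorbs the difference quotient, value at [x] included. The rules below become
    limits of sums and products, and the chain rule needs no separate case [f z = f x]. *)
Lemma caratheodory_within D f x l :
  has_derivative_within D f x l <->
  exists phi, [/\ forall z, D z -> f z - f x = phi z * (z - x),
    phi @ within D (nbhs x) --> l & phi x = l].
Proof.
split=> [/derivative_withinP fl|[phi [fE phil _]]].
  exists (fun z => if z == x then l else (f z - f x) / (z - x)); split=> //.
  - move=> z Dz /=; case: eqVneq => [->|zx]; first by rewrite !subrr mulr0.
    by rewrite divfK// subr_eq0.
  - apply/cvg_withinP => e e0; have [d d0 dfl] := fl e e0.
    exists d => // z Dz zxd /=; case: eqVneq => [_|zx].
      by rewrite subrr normr0 ltW.
    have zx0 : z - x != 0 by rewrite subr_eq0.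
    have zx1 : 0 < `|z - x| by rewrite normr_gt0.
    by rewrite -(ler_pM2r zx1) -normrM mulrBl divfK// dfl.
  - by rewrite eqxx.
apply/derivative_withinP => e e0.
have [d d0 dphi] := (cvg_withinP _ _ _ _).1 phil e e0.
exists d => // z Dz zx; rewrite fE// -mulrBl normrM ler_wpM2r//.
exact: dphi.
Qed.

Lemma derivative_within_cvg D f x l :
  has_derivative_within D f x l -> f @ within D (nbhs x) --> f x.
Proof.
move=> /derivative_withinP fl; apply/cvg_withinP => e e0.
have [d d0 dfl] := fl 1 ltr01.
have k0 : 0 < 1 + `|l| by rewrite ltr_wpDr.
exists (Num.min d (e / (1 + `|l|))) => [|z Dz].
  by rewrite lt_min d0 divr_gt0.
rewrite lt_min => /andP[zd]; rewrite ltr_pdivlMr// => ze.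
rewrite -[f z - f x](subrK (l * (z - x))).
apply: (le_trans (ler_normD _ _)); apply: le_trans (ltW ze).
by rewrite [leRHS]mulrDr mulr1 normrM [`|l| * _]mulrC lerD2r -[leRHS]mul1r dfl.
Qed.

Lemma derivative_within_continuous D f df :
  (forall x, D x -> has_derivative_within D f x (df x)) ->
  {within D, continuous f}.
Proof.
move=> fdf; apply/subspace_continuousP => x Dx.
exact: derivative_within_cvg (fdf x Dx).
Qed.

Lemma derivative_withinS D E f x l : D `<=` E ->
  has_derivative_within E f x l -> has_derivative_within D f x l.
Proof.
move=> DE /derivative_withinP fl; apply/derivative_withinP => e /fl[d d0 dfl].
by exists d => // z /DE; exact: dfl.
Qed.

Lemma eq_derivative_within D f g x l : D x -> {in D, f =1 g} ->
  has_derivative_within D f x l -> has_derivative_within D g x l.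
Proof.
move=> Dx fg /derivative_withinP fl; apply/derivative_withinP => e /fl[d d0 dfl].
by exists d => // z Dz zx; rewrite -!fg ?inE//; exact: dfl.
Qed.

Lemma derivative_within_cst D (c x : R) :
  has_derivative_within D (fun=> c) x 0.
Proof.
by apply/caratheodory_within; exists (fun=> 0); split=> //;
  [move=> z _; rewrite mul0r subrr|exact: cvg_cst].
Qed.

Lemma derivative_within_id D (x : R) : has_derivative_within D id x 1.
Proof.
by apply/caratheodory_within; exists (fun=> 1); split=> //;
  [move=> z _; rewrite mul1r|exact: cvg_cst].
Qed.

Lemma derivative_withinD D f g x l m :
  has_derivative_within D f x l -> has_derivative_within D g x m ->
  has_derivative_within D (fun z => f z + g z) x (l + m).
Proof.
move=> /caratheodory_within[u [fu ul ux]] /caratheodory_within[v [gv vm vx]].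
apply/caratheodory_within; exists (fun z => u z + v z); split.
- by move=> z Dz; rewrite mulrDl -fu// -gv//; ring.
- exact: cvgD.
- by rewrite ux vx.
Qed.

Lemma derivative_withinM D f g x l m :
  has_derivative_within D f x l -> has_derivative_within D g x m ->
  has_derivative_within D (fun z => f z * g z) x (l * g x + f x * m).
Proof.
move=> fl gm; have gx := derivative_within_cvg gm.
move: fl gm => /caratheodory_within[u [fu ul ux]]
  /caratheodory_within[v [gv vm vx]].
apply/caratheodory_within; exists (fun z => u z * g z + f x * v z); split.
- move=> z Dz; rewrite mulrDl mulrAC -fu// -mulrA -gv//; ring.
- by apply: cvgD; apply: cvgM => //; exact: cvg_cst.
- by rewrite ux vx.
Qed.

Lemma derivative_withinMl D f x l (c : R) :
  has_derivative_within D f x l ->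
  has_derivative_within D (fun z => c * f z) x (c * l).
Proof.
move=> fl; have := derivative_withinM (derivative_within_cst D c x) fl.
by rewrite mul0r add0r.
Qed.

Lemma derivative_withinN D f x l :
  has_derivative_within D f x l ->
  has_derivative_within D (fun z => - f z) x (- l).
Proof.
move=> /derivative_withinP fl; apply/derivative_withinP => e /fl[d d0 dfl].
exists d => // z Dz zx; have := dfl z Dz zx.
by rewrite -normrN !opprD !opprK mulNr opprK.
Qed.

Lemma derivative_withinB D f g x l m :
  has_derivative_within D f x l -> has_derivative_within D g x m ->
  has_derivative_within D (fun z => f z - g z) x (l - m).
Proof. by move=> fl /derivative_withinN; exact: derivative_withinD. Qed.

Lemma derivative_withinV D f x l : D x -> f x != 0 ->
  has_derivative_within D f x l ->
  has_derivative_within D (fun z => (f z)^-1) x (- l * ((f x)^-1 * (f x)^-1)).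
Proof.
move=> Dx fx0 fl; have fx := derivative_within_cvg fl.
have [d d0 fd] : exists2 d, 0 < d &
    forall z, D z -> `|z - x| < d -> f z != 0.
  have e0 : 0 < `|f x| / 2 by rewrite divr_gt0// normr_gt0.
  have [d d0 df] := (cvg_withinP _ _ _ _).1 fx _ e0.
  exists d => // z Dz /(df z Dz); apply: contraTN => /eqP ->.
  by rewrite sub0r normrN -ltNge ltr_pdivrMr// ltr_pMr ?normr_gt0// ltr1n.
move: (fl) => /caratheodory_within[u [fu ul ux]].
have : (fun z => - u z * ((f z)^-1 * (f x)^-1)) @ within D (nbhs x) -->
    - l * ((f x)^-1 * (f x)^-1).
  apply: cvgM; first exact: cvgN.
  by apply: cvgM; [exact: cvgV|exact: cvg_cst].
move=> /cvg_withinP vl; apply/derivative_withinP => e e0.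
have [d' d'0 dv] := vl e e0.
exists (Num.min d d') => [|z Dz]; first by rewrite lt_min d0.
rewrite lt_min => /andP[zd zd'].
have fz := fd z Dz zd.
have -> : (f z)^-1 - (f x)^-1 = - u z * ((f z)^-1 * (f x)^-1) * (z - x).
  by rewrite mulrAC mulNr -fu//; field; rewrite fx0 fz.
by rewrite -mulrBl normrM ler_wpM2r// dv.
Qed.

Lemma derivative_within_comp D E f g x l m :
  D x -> (forall z, D z -> E (f z)) ->
  has_derivative_within D f x l -> has_derivative_within E g (f x) m ->
  has_derivative_within D (g \o f) x (m * l).
Proof.
move=> Dx fDE fl; have fx := derivative_within_cvg fl.
move: fl => /caratheodory_within[u [fu ul ux]].
move=> /caratheodory_within[v [gv vm vx]].
apply/caratheodory_within; exists (fun z => v (f z) * u z); split.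
- by move=> z Dz; rewrite /= gv ?fu ?mulrA//; exact: fDE.
- by apply: cvgM => //; exact: cvg_within_comp vm.
- by rewrite ux vx.
Qed.

(* As [g] expands distances, [g \o f] controls the increments of [f]. *)
Lemma derivative_within_inverse D E f g x l m : D x ->
  (forall z, D z -> E (f z)) ->
  (forall z w, E z -> E w -> `|z - w| <= `|g z - g w|) -> m != 0 ->
  has_derivative_within E g (f x) m -> has_derivative_within D (g \o f) x l ->
  has_derivative_within D f x (l / m).
Proof.
move=> Dx fDE gexp m0 gm fl.
have /cvg_withinP gfx := derivative_within_cvg fl.
have fx : f @ within D (nbhs x) --> f x.
  apply/cvg_withinP => e /gfx[d d0 dgf]; exists d => // z Dz zx.
  by apply: le_trans (dgf z Dz zx); apply: gexp; exact: fDE.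
move: gm => /caratheodory_within[v [gv vm vx]].
have vf : (v \o f) @ within D (nbhs x) --> m by exact: cvg_within_comp vm.
move: fl => /caratheodory_within[u [gfu ul ux]].
have vN0 z : D z -> f z != f x -> v (f z) != 0.
  move=> Dz fzx; apply/eqP => vz.
  have := gexp _ _ (fDE z Dz) (fDE x Dx).
  rewrite gv ?vz ?mul0r ?normr0; last exact: fDE.
  by rewrite normr_le0 subr_eq0 (negbTE fzx).
have [d1 d10 vf0] : exists2 d, 0 < d &
    forall z, D z -> `|z - x| < d -> v (f z) != 0.
  have e0 : 0 < `|m| / 2 by rewrite divr_gt0// normr_gt0.
  have [d d0 dv] := (cvg_withinP _ _ _ _).1 vf _ e0.
  exists d => // z Dz /(dv z Dz) /=; apply: contraTN => /eqP ->.
  by rewrite sub0r normrN -ltNge ltr_pdivrMr// ltr_pMr ?normr_gt0// ltr1n.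
have /cvg_withinP uv : (fun z => u z / v (f z)) @ within D (nbhs x) --> l / m.
  by apply: cvgM => //; exact: cvgV.
apply/derivative_withinP => e /uv[d d0 duv].
exists (Num.min d d1) => [|z Dz]; first by rewrite lt_min d0.
rewrite lt_min => /andP[zd zd1].
have -> : f z - f x = u z / v (f z) * (z - x).
  rewrite mulrAC -gfu// /= gv; last exact: fDE.
  by rewrite mulrAC divff ?mul1r//; exact: vf0.
by rewrite -mulrBl normrM ler_wpM2r// duv.
Qed.

Lemma derivative_within_interior D f (x l : R) :
  (\forall z \near x, D z) -> has_derivative_within D f x l <->
  is_derive x 1 f l.
Proof.
move=> /nbhs_ballP[d /= d0 dD]; split.
  move=> /caratheodory_within[u [fu ul ux]].
  apply/is_derive1_caratheodory.
  exists (fun z => if z == x then l else (f z - f x) / (z - x)); split.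
  - move=> z /=; case: eqVneq => [->|zx]; first by rewrite !subrr mulr0.
    by rewrite divfK// subr_eq0.
  - apply/cvgrPdist_le => e e0; rewrite eqxx.
    have [d' d'0 du] := (cvg_withinP _ _ _ _).1 ul e e0.
    apply/nbhs_ballP; exists (Num.min d d') => /=; first by rewrite lt_min d0.
    move=> z; rewrite /ball /= lt_min => /andP[zd zd'].
    case: eqVneq => [_|zx]; first by rewrite subrr normr0 ltW.
    have Dz : D z by exact: dD.
    by rewrite fu// mulfK ?subr_eq0// distrC du// distrC.
  - by rewrite eqxx.
move=> /is_derive1_caratheodory[u [fu uc ux]].
apply/caratheodory_within; exists u; split => //.
by rewrite -ux; apply: cvg_within_filter; exact: uc.
Qed.

Lemma is_derive_derivative_within D f (x l : R) : is_derive x 1 f l ->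
  has_derivative_within D f x l.
Proof.
move=> fl; apply: (derivative_withinS (@subsetT _ D)).
by apply/derivative_within_interior => //; exact: filterT.
Qed.

Lemma near_itv (u v x : R) : u < x < v -> \forall z \near x, `[u, v] z.
Proof.
move=> /andP[ux xv]; near=> z; rewrite /= in_itv/=; apply/andP; split; apply: ltW.
- by near: z; exact: lt_nbhsr.
- by near: z; exact: lt_nbhsl.
Unshelve. all: by end_near. Qed.

Lemma derivative_within_itv_is_derive (u v : R) f (x l : R) : u < x < v ->
  has_derivative_within `[u, v] f x l -> is_derive x 1 f l.
Proof. by move=> /near_itv uxv; rewrite derivative_within_interior. Qed.

(** Each point of a nondegenerate segment is a limit of other points of it, so two linear
    approximations can be compared there, even at an end. *)
Lemma derivative_within_itv_unique (u v : R) f x l m : u < v ->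
  `[u, v] x ->
  has_derivative_within `[u, v] f x l -> has_derivative_within `[u, v] f x m ->
  l = m.
Proof.
move=> uv; rewrite /= in_itv/= => /andP[ux xv].
move=> /derivative_withinP fl /derivative_withinP fm.
apply/eqP; rewrite -subr_eq0 -normr_le0; apply/ler_addgt0Pl => e e0.
rewrite addr0.
have e20 : 0 < e / 2 by rewrite divr_gt0.
have [d d0 dl] := fl _ e20; have [d' d'0 dm] := fm _ e20.
have [z [zuv zx zd]] : exists z, [/\ `[u, v] z, z != x & `|z - x| < Num.min d d'].
  set r := Num.min d d'; have r0 : 0 < r by rewrite lt_min d0.
  have r20 : 0 < r / 2 by rewrite divr_gt0.
  have r2r : r / 2 < r by rewrite ltr_pdivrMr// ltr_pMr// ltr1n.
  (* The test point lies to the right of [x], or to the left when [x = v]; [Num.min] and [Num.max]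
     keep it in the segment. *)
  have [xv'|xv'] := ltP x v.
    exists (Num.min v (x + r / 2)); split.
    - rewrite /= in_itv/= ge_min lexx/= le_min (ltW uv)/=.
      by rewrite (le_trans ux)// lerDl ltW.
    - by rewrite gt_eqF// lt_min xv' ltrDl.
    - rewrite ger0_norm; last by rewrite subr_ge0 le_min xv lerDl ltW.
      by rewrite ltrBlDl gt_min ltrD2l r2r orbT.
  have {xv xv'}xE : x = v by apply/eqP; rewrite eq_le xv xv'.
  exists (Num.max u (x - r / 2)); split.
  - rewrite /= in_itv/= le_max lexx/= ge_max (ltW uv)/=.
    by rewrite -xE lerBlDr lerDl ltW.
  - by rewrite lt_eqF// gt_max xE uv ltrBlDr ltrDl.
  - rewrite distrC ger0_norm; last by rewrite subr_ge0 ge_max ux lerBlDr lerDl ltW.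
    by rewrite ltrBlDr -ltrBlDl lt_max ltrD2l ltrN2 r2r orbT.
move: zd; rewrite lt_min => /andP[zd zd'].
have zx0 : 0 < `|z - x| by rewrite normr_gt0 subr_eq0.
rewrite -(ler_pM2r zx0) -normrM.
have -> : (l - m) * (z - x) =
    (f z - f x - m * (z - x)) - (f z - f x - l * (z - x)) by ring.
apply: (le_trans (ler_normB _ _)).
apply: (le_trans (lerD (dm z zuv zd') (dl z zuv zd))).
by rewrite -mulrDl -splitr.
Qed.

Lemma MVT_within (u v : R) f df : u <= v ->
  (forall x, `[u, v] x -> has_derivative_within `[u, v] f x (df x)) ->
  exists2 c, `[u, v] c & f v - f u = df c * (v - u).
Proof.
move=> uv fdf; have [c cuv fE] : exists2 c, c \in `[u, v]%R &
    f v - f u = df c * (v - u).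
  apply: MVT_segment => // [x|].
    rewrite in_itv/= => uxv; apply: derivative_within_itv_is_derive (uxv) _.
    by apply: fdf; rewrite /= in_itv/=; move: uxv => /andP[/ltW-> /ltW->].
  exact: derivative_within_continuous fdf.
by exists c.
Qed.

Lemma derivative_within_eq_itv (u v : R) f g df :
  (forall x, `[u, v] x -> has_derivative_within `[u, v] f x (df x)) ->
  (forall x, `[u, v] x -> has_derivative_within `[u, v] g x (df x)) ->
  f u = g u -> forall x, `[u, v] x -> f x = g x.
Proof.
move=> fdf gdf fgu x; rewrite /= in_itv/= => /andP[ux xv].
have uxuv : `[u, x] `<=` `[u, v] by apply: subset_itvl; rewrite bnd_simp.
have [|c _] := @MVT_within u x (fun z => f z - g z) (fun=> 0) ux.
  move=> z zux; rewrite -(subrr (df z)).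
  by apply: derivative_withinB;
    apply: (derivative_withinS uxuv); [apply: fdf|apply: gdf]; exact: uxuv.
by rewrite mul0r fgu subrr subr0 => /eqP; rewrite subr_eq0 => /eqP.
Qed.

(** Constancy in the open interval makes the derivative vanish there; the mean value theorem, which
    asks only for continuity at the ends, then reaches them. *)
Lemma cst_within_itv (u v : R) f : {within `[u, v], continuous f} ->
  (forall x z, u < x -> x < z -> z < v -> f z = f x) ->
  forall x, `[u, v] x -> f x = f v.
Proof.
move=> fc fE x; rewrite /= in_itv/= => /andP[ux xv].
have fcx : {within `[x, v], continuous f}.
  by apply: continuous_subspaceW fc; apply: subset_itvr; rewrite bnd_simp.
have [z|c _] := MVT_segment xv _ fcx (df := fun=> 0); last first.
  by rewrite mul0r => /eqP; rewrite subr_eq0 => /eqP.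
rewrite in_itv/= => /andP[xz zv]; have uz := le_lt_trans ux xz.
apply: (@near_eq_is_derive _ _ _ (cst (f z))).
near=> w.
have uw : u < w by near: w; exact: lt_nbhsr.
have wv : w < v by near: w; exact: lt_nbhsl.
by have [wz|zw|->//] := ltgtP w z; [exact: fE|apply/esym/fE].
Unshelve. all: by end_near. Qed.

End derivative_within.

(** * Smoothness on a segment, order by order *)

Section smoothness.
Context {R : realType}.
Implicit Types (D : set R) (f g : R -> R) (n : nat).

(** A finite-order counterpart of [Coo_on]. The profile satisfies a nonlinear first-order equation,
    so its regularity is gained one order at a time, by induction on [n]. *)
Fixpoint n_times_derivable D n f : Prop :=
  if n is m.+1 then exists2 g,
    forall x, D x -> has_derivative_within D f x (g x) & n_times_derivable D m g
  else True.

Lemma eq_n_times_derivable D n f g : {in D, f =1 g} ->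
  n_times_derivable D n f -> n_times_derivable D n g.
Proof.
case: n => //= n fg [h fh nh]; exists h => // x Dx.
by apply: eq_derivative_within (fh x Dx).
Qed.

Lemma n_times_derivableW D n f :
  n_times_derivable D n.+1 f -> n_times_derivable D n f.
Proof.
elim: n f => //= n IH f [g fg ng]; exists g => //.
by apply: IH.
Qed.

Lemma n_times_derivable_cst D n (c : R) : n_times_derivable D n (fun=> c).
Proof.
elim: n c => //= n IH c; exists (fun=> 0) => // x Dx.
exact: derivative_within_cst.
Qed.

Lemma n_times_derivable_id D n : n_times_derivable D n id.
Proof.
case: n => //= n; exists (fun=> 1); last exact: n_times_derivable_cst.
by move=> x Dx; exact: derivative_within_id.
Qed.

Lemma n_times_derivableD D n f g :
  n_times_derivable D n f -> n_times_derivable D n g ->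
  n_times_derivable D n (fun x => f x + g x).
Proof.
elim: n f g => //= n IH f g [f' ff' nf'] [g' gg' ng'].
exists (fun x => f' x + g' x); last exact: IH.
by move=> x Dx; apply: derivative_withinD; [exact: ff'|exact: gg'].
Qed.

Lemma n_times_derivableM D n f g :
  n_times_derivable D n f -> n_times_derivable D n g ->
  n_times_derivable D n (fun x => f x * g x).
Proof.
elim: n f g => //= n IH f g nf ng.
have nf0 := n_times_derivableW nf.
have ng0 := n_times_derivableW ng.
case: nf => f' ff' nf'; case: ng => g' gg' ng'.
exists (fun x => f' x * g x + f x * g' x).
  by move=> x Dx; apply: derivative_withinM; [exact: ff'|exact: gg'].
by apply: n_times_derivableD; exact: IH.
Qed.

Lemma n_times_derivableN D n f :
  n_times_derivable D n f -> n_times_derivable D n (fun x => - f x).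
Proof.
move=> nf; apply: (@eq_n_times_derivable _ _ (fun x => -1 * f x)).
  by move=> x _; rewrite mulN1r.
by apply: n_times_derivableM => //; exact: n_times_derivable_cst.
Qed.

Lemma n_times_derivableX D n f k :
  n_times_derivable D n f -> n_times_derivable D n (fun x => f x ^+ k).
Proof.
move=> nf; elim: k => [|k IH].
  exact: n_times_derivable_cst.
under eq_fun do rewrite exprS.
exact: n_times_derivableM.
Qed.

Lemma n_times_derivableV D n f : (forall x, D x -> f x != 0) ->
  n_times_derivable D n f -> n_times_derivable D n (fun x => (f x)^-1).
Proof.
move=> f0; elim: n => //= n IH nf.
have nV := IH (n_times_derivableW nf).
case: nf => f' ff' nf'.
exists (fun x => - f' x * ((f x)^-1 * (f x)^-1)).
  by move=> x Dx; apply: derivative_withinV; [|exact: f0|exact: ff'].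
apply: n_times_derivableM; first exact: n_times_derivableN.
exact: n_times_derivableM.
Qed.

(** Each derivative lowers the exponent by one, so the induction runs over all real [q]; strict
    positivity keeps the power rule valid whatever the sign of the exponent. *)
Lemma n_times_derivable_powR D n f (q : R) : (forall x, D x -> 0 < f x) ->
  n_times_derivable D n f -> n_times_derivable D n (fun x => f x `^ q).
Proof.
move=> f0; elim: n q => //= n IH q nf.
have nP := IH (q - 1) (n_times_derivableW nf).
case: nf => f' ff' nf'.
exists (fun x => q * f x `^ (q - 1) * f' x).
  move=> x Dx; apply: (@derivative_within_comp _ _ setT f (@powR R ^~ q)) => //.
    exact: ff'.
  apply: is_derive_derivative_within; apply: is_derive1_powR.
  exact: f0.
apply: n_times_derivableM => //.
by apply: n_times_derivableM => //; exact: n_times_derivable_cst.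
Qed.

Lemma n_times_derivable_expR D n f :
  n_times_derivable D n f -> n_times_derivable D n (fun x => expR (f x)).
Proof.
elim: n => //= n IH nf; have nE := IH (n_times_derivableW nf).
case: nf => f' ff' nf'; exists (fun x => expR (f x) * f' x).
  move=> x Dx; apply: (@derivative_within_comp _ _ setT f expR) => //.
    exact: ff'.
  by apply: is_derive_derivative_within; exact: is_derive_expR.
exact: n_times_derivableM.
Qed.

(** Witnesses for different orders need not fit together a priori. On a nondegenerate segment they
    do, the derivative being unique, so iterating one chosen derivative [der] gives the whole
    sequence. *)
Lemma Coo_onP (u v : R) f : u < v ->
  Coo_on `[u, v] f <-> forall n, n_times_derivable `[u, v] n f.
Proof.
move=> uv; split.
  move=> [d [d0 dd]] n.
  apply: (@eq_n_times_derivable _ _ (d 0%N)).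
    by move=> x; rewrite inE; exact: d0.
  elim: n 0%N => //= n IH k; exists (d k.+1) => // x xuv.
  exact: dd.
move=> nf.
pose is_der (g h : R -> R) :=
  forall x, `[u, v] x -> has_derivative_within `[u, v] g x (h x).
pose der g := xget (cst 0) [set h | is_der g h].
have derP g h : is_der g h -> is_der g (der g).
  by move=> gh; rewrite /der; case: xgetP => // /(_ h); exact.
exists (fun n => iter n der f); split=> // n x xuv.
have : forall m, n_times_derivable `[u, v] m (iter n der f).
  elim: n => //= n IH m.
  have [h gh nh] := IH m.+1.
  apply: eq_n_times_derivable nh => z; rewrite inE => zuv.
  exact: (derivative_within_itv_unique uv zuv (gh z zuv)
    (derP _ _ gh z zuv)).
by move=> /(_ 1%N)[h gh _]; exact: derP gh x xuv.
Qed.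

End smoothness.

(** * Integrals over segments *)

Section interval_integrals.
Context {R : realType}.
Local Notation mu := (@lebesgue_measure R).
Implicit Types (f g b : R -> R) (u v w x : R).

Lemma integrable_itvS u v x w f : u <= x -> w <= v ->
  mu.-integrable `[u, v] (EFin \o f) -> mu.-integrable `[x, w] (EFin \o f).
Proof.
move=> ux wv; apply: integrableS => //.
by apply: subset_itv; rewrite bnd_simp.
Qed.

Lemma Rintegral_chasles u w v f : u <= w -> w <= v ->
  mu.-integrable `[u, v] (EFin \o f) ->
  \int[mu]_(z in `[u, v]) f z =
  \int[mu]_(z in `[u, w]) f z + \int[mu]_(z in `[w, v]) f z.
Proof.
move=> uw wv fi; apply/eqP; rewrite addrC -subr_eq; apply/eqP.
rewrite Rintegral_itvB ?bnd_simp// Rintegral_itv_obnd_cbnd//.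
apply: integrableS fi => //; apply: subset_itvr; rewrite bnd_simp.
exact: uw.
Qed.

Lemma integrable_cst_itv u v (c : R) :
  mu.-integrable `[u, v] (EFin \o (fun=> c)).
Proof.
apply: continuous_compact_integrable; first exact: segment_compact.
by apply: continuous_subspaceT => z; exact: cvg_cst.
Qed.

Lemma Rintegral_cst_itv u v (c : R) : u <= v ->
  \int[mu]_(z in `[u, v]) c = c * (v - u).
Proof.
move=> uv; rewrite Rintegral_cst//= lebesgue_measure_itv/= lte_fin.
by case: ltgtP uv => //= -> _; rewrite subrr.
Qed.

Lemma ler_norm_Rintegral u v f g :
  mu.-integrable `[u, v] (EFin \o f) -> mu.-integrable `[u, v] (EFin \o g) ->
  (forall z, `[u, v] z -> `|f z| <= g z) ->
  `|\int[mu]_(z in `[u, v]) f z| <= \int[mu]_(z in `[u, v]) g z.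
Proof.
move=> fi gi fg; apply: (le_trans (le_normr_Rintegral _ _)) => //.
by apply: le_Rintegral => //; exact: integrable_norm.
Qed.

(** Continuity at the single point [x] suffices: near it [f] differs from [f x] by at most [e],
    hence so do its averages between [x] and [z]. *)
Lemma derivative_within_integral u v x f :
  mu.-integrable `[u, v] (EFin \o f) -> `[u, v] x ->
  f @ within `[u, v] (nbhs x) --> f x ->
  has_derivative_within `[u, v] (fun y => \int[mu]_(z in `[u, y]) f z) x (f x).
Proof.
move=> fi xuv fx.
have main (a b c e : R) : u <= a -> a <= b -> b <= v ->
    (forall z, `[a, b] z -> `|f z - c| <= e) ->
    `|\int[mu]_(z in `[u, b]) f z - \int[mu]_(z in `[u, a]) f z - c * (b - a)|
    <= e * (b - a).
  move=> ua ab bv fe.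
  have fb : mu.-integrable `[u, b] (EFin \o f) by exact: integrable_itvS fi.
  have fab : mu.-integrable `[a, b] (EFin \o f) by exact: integrable_itvS fi.
  rewrite (Rintegral_chasles ua ab fb) [X in X - c * _]addrAC subrr add0r.
  rewrite -!Rintegral_cst_itv// -RintegralB//; last exact: integrable_cst_itv.
  apply: ler_norm_Rintegral => //; last exact: integrable_cst_itv.
  rewrite (_ : _ \o _ = (fun z => (f z)%:E - c%:E)%E)//.
  by apply: integrableB => //; exact: integrable_cst_itv.
apply/derivative_withinP => e e0.
have [d d0 df] := (cvg_withinP _ _ _ _).1 fx e e0.
have {}df z w : `[u, v] z -> `|z - x| < d ->
    (x <= w <= z) || (z <= w <= x) -> `|f w - f x| <= e.
  move=> zuv zx w_; move: xuv zuv; rewrite /= !in_itv/= => /andP[ux xv] /andP[uz zv].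
  apply: df.
    by rewrite /= in_itv/=; lra.
  apply: le_lt_trans zx; case/orP: w_ => /andP[? ?].
    by rewrite !ger0_norm ?subr_ge0//; lra.
  by rewrite !ler0_norm ?subr_le0//; lra.
exists d => // z zuv zx; move: (df z).
move: xuv (zuv); rewrite /= !in_itv/= => /andP[ux xv] /andP[uz zv] df1.
have [xz|zx'] := leP x z.
  rewrite (ger0_norm (_ : 0 <= z - x)) ?subr_ge0//; apply: main => // w.
  by rewrite /= in_itv/= => xwz; apply: df1 => //; rewrite ?xwz// uz zv.
rewrite (ler0_norm (_ : z - x <= 0)); last by rewrite subr_le0 ltW.
rewrite [- (z - x)]opprB.
have -> : \int[mu]_(z0 in `[u, z]) f z0 - \int[mu]_(z0 in `[u, x]) f z0 -
   f x * (z - x) = - (\int[mu]_(z0 in `[u, x]) f z0 -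
   \int[mu]_(z0 in `[u, z]) f z0 - f x * (x - z)) by ring.
rewrite normrN. apply: main => //; first exact: ltW.
move=> w; rewrite /= in_itv/= => zwx; apply: df1 => //.
by rewrite zwx orbT.
Qed.

Lemma integrable_continuous_itv u v f : {within `[u, v], continuous f} ->
  mu.-integrable `[u, v] (EFin \o f).
Proof.
by move=> fc; apply: continuous_compact_integrable => //; exact: segment_compact.
Qed.

Lemma integrableM_continuous u v b f :
  mu.-integrable `[u, v] (EFin \o b) -> {within `[u, v], continuous f} ->
  mu.-integrable `[u, v] (EFin \o (fun z => b z * f z)).
Proof.
move=> bi fc; have mf : measurable_fun `[u, v] f.
  by apply: measurable_realfun.subspace_continuous_measurable_fun.
have bf : [bounded f x | x in `[u, v]].
  have /compact_bounded[M [Mr Mf]] :=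
    continuous_compact fc (segment_compact (a := u) (b := v)).
  by exists M; split=> // M' MM' z zuv; apply: Mf => //; exists z.
exact: (integrableMl _ bi mf bf).
Qed.

Lemma Rintegral_derivative u v f F :
  (forall x, `[u, v] x -> has_derivative_within `[u, v] F x (f x)) ->
  {within `[u, v], continuous f} ->
  forall x, `[u, v] x -> \int[mu]_(z in `[u, x]) f z = F x - F u.
Proof.
move=> Ff fc x xuv.
have uv : u <= v.
  by move: xuv; rewrite /= in_itv/= => /andP[/le_trans]; exact.
apply: (@derivative_within_eq_itv _ u v (fun x => \int[mu]_(z in `[u, x]) f z)
  (fun x => F x - F u) f) => //.
- move=> y yuv; apply: derivative_within_integral => //.
  + exact: integrable_continuous_itv.
  + by move/subspace_continuousP : fc; exact.
- move=> y yuv; rewrite -[f y]subr0; apply: derivative_withinB; first exact: Ff.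
  exact: derivative_within_cst.
- by rewrite set_itv1 Rintegral_set1 subrr.
Qed.

(* Up to (E(z) - E(x)) int_u^x b, the increment from x to z is the integral over
   [x, z] of b(xi) (E(z) - E(xi)), which is O(|z - x|) times that of |b|. *)
Lemma derivative_within_integralM u v b E e :
  mu.-integrable `[u, v] (EFin \o b) ->
  (forall x, `[u, v] x -> has_derivative_within `[u, v] E x (e x)) ->
  {within `[u, v], continuous e} ->
  forall x, `[u, v] x ->
  has_derivative_within `[u, v]
    (fun y => E y * \int[mu]_(z in `[u, y]) b z -
              \int[mu]_(z in `[u, y]) (b z * E z)) x
    (e x * \int[mu]_(z in `[u, x]) b z).
Proof.
move=> bi Ee ec x xuv.
have uv : u <= v by move: xuv; rewrite /= in_itv/= => /andP[/le_trans]; exact.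
have Ec := derivative_within_continuous Ee.
(* A bound of the continuous derivative [e] on the compact segment is a Lipschitz constant of
   [E]. *)
have [M M0 EM] : exists2 M, 0 < M & forall z w, `[u, v] z -> `[u, v] w ->
    `|E z - E w| <= M * `|z - w|.
  have /compact_bounded[M0 [_ Mf]] :=
    continuous_compact ec (segment_compact (a := u) (b := v)).
  pose M := `|M0| + 1; exists M; first by rewrite /M ltr_wpDl.
  have eM c : `[u, v] c -> `|e c| <= M.
    move=> cuv; apply: (Mf M) => /=; last by exists c.
    by rewrite /M (le_lt_trans (ler_norm _))// ltrDl.
  move=> z w; wlog : z w / w <= z => [H zuv wuv|wz zuv wuv].
    have [wz|/ltW zw] := leP w z; first exact: H.
    by rewrite distrC [`|z - _|]distrC; exact: H.
  have wzuv : `[w, z] `<=` `[u, v].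
    move: zuv wuv; rewrite /= !in_itv/= => /andP[? ?] /andP[? ?].
    by apply: subset_itv; rewrite bnd_simp.
  have [|c cwz ->] := @MVT_within _ w z E e wz.
    by move=> y /wzuv yuv; apply: derivative_withinS (Ee y yuv).
  by rewrite normrM ler_wpM2r// eM//; exact: wzuv.
have bEi : mu.-integrable `[u, v] (EFin \o (fun z => b z * E z)).
  exact: integrableM_continuous.
have Nbi : mu.-integrable `[u, v] (EFin \o (Num.norm \o b)).
  exact: integrable_norm.
pose B y := \int[mu]_(z in `[u, y]) b z.
pose C y := \int[mu]_(z in `[u, y]) (b z * E z).
pose N y := \int[mu]_(z in `[u, y]) (Num.norm \o b) z.
(* [y] stands for the moving point [z]: it is the right end of the interval when [x <= z] and the
   left end otherwise. *)
have main a c y : u <= a -> a <= c -> c <= v -> y = a \/ y = c ->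
    `|E y * (B c - B a) - (C c - C a)| <= M * (c - a) * (N c - N a).
  move=> ua ac cv yac.
  have icv f : mu.-integrable `[u, v] (EFin \o f) ->
      mu.-integrable `[u, c] (EFin \o f) /\ mu.-integrable `[a, c] (EFin \o f).
    by move=> fi; split; apply: integrable_itvS fi.
  have [b1 b2] := icv _ bi; have [bE1 bE2] := icv _ bEi.
  have [Nb1 Nb2] := icv _ Nbi.
  rewrite /B /C /N (Rintegral_chasles ua ac b1) (Rintegral_chasles ua ac bE1).
  rewrite (Rintegral_chasles ua ac Nb1).
  rewrite ![_ + \int[mu]_(_ in `[a, c]) _]addrC !addrK.
  rewrite -!RintegralZl// -RintegralB//; last first.
    rewrite (_ : _ \o _ = (fun z => (E y)%:E * (b z)%:E)%E)//.
    exact: integrableZl.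
  apply: ler_norm_Rintegral => //.
  - rewrite (_ : _ \o _ = (fun z => (E y)%:E * (b z)%:E - (b z * E z)%:E)%E)//.
    by apply: integrableB => //; exact: integrableZl.
  - rewrite (_ : _ \o _ =
      (fun z => (M * (c - a))%:E * ((Num.norm \o b) z)%:E)%E)//.
    exact: integrableZl.
  move=> z; rewrite /= in_itv/= => /andP[az zc].
  rewrite [b z * _]mulrC -mulrBl normrM ler_wpM2r//.
  have zuv : `[u, v] z by rewrite /= in_itv/=; lra.
  have yuv : `[u, v] y by rewrite /= in_itv/=; case: yac => ->; lra.
  apply: (le_trans (EM _ _ yuv zuv)); rewrite ler_pM2l//.
  case: yac => ->.
    by rewrite distrC ger0_norm ?subr_ge0//; lra.
  by rewrite ger0_norm ?subr_ge0//; lra.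
have /cvg_withinP Nx : N @ within `[u, v] (nbhs x) --> N x.
  have := parameterized_integral_continuous uv Nbi.
  by move=> /subspace_continuousP; exact.
apply/derivative_withinP => eps eps0.
have K0 : 0 < `|B x| + M by rewrite ltr_wpDl.
(* The two errors are at most [|B x|] and [M] times this number times [|z - x|], so they add up to
   [eps * |z - x|]. *)
have e20 : 0 < eps / (`|B x| + M) by rewrite divr_gt0.
have [d1 d10 dE] := (derivative_withinP _ _ _ _).1 (Ee x xuv) _ e20.
have [d2 d20 dN] := Nx _ e20.
exists (Num.min d1 d2) => [|z zuv]; first by rewrite lt_min d10.
rewrite lt_min => /andP[zd1 zd2].
have {dE} := dE z zuv zd1; have {dN} := dN z zuv zd2 => dN dE.
have {main} mainz : `|E z * (B z - B x) - (C z - C x)| <=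
    M * `|z - x| * (eps / (`|B x| + M)).
  move: xuv zuv; rewrite /= !in_itv/= => /andP[ux xv] /andP[uz zv].
  apply: (@le_trans _ _ (M * `|z - x| * `|N z - N x|)); last first.
    by rewrite ler_wpM2l// mulr_ge0// ltW.
  have [xz|/ltW zx] := leP x z.
    rewrite (ger0_norm (_ : 0 <= z - x)) ?subr_ge0//.
    apply: (le_trans (main x z z ux xz zv (or_intror erefl))).
    by rewrite ler_wpM2l ?ler_norm// mulr_ge0 ?subr_ge0// ltW.
  rewrite distrC [`|N _ - _|]distrC [`|z - x|]distrC (ger0_norm (_ : 0 <= x - z)) ?subr_ge0//.
  have -> : `|C z - C x - E z * (B z - B x)| =
      `|E z * (B x - B z) - (C x - C z)| by congr (`|_|); ring.
  apply: (le_trans (main z x z uz zx xv (or_introl erefl))).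
  by rewrite ler_wpM2l ?ler_norm// mulr_ge0 ?subr_ge0// ltW.
have -> : E z * B z - C z - (E x * B x - C x) - e x * B x * (z - x) =
    B x * (E z - E x - e x * (z - x)) + (E z * (B z - B x) - (C z - C x)).
  by ring.
apply: (le_trans (ler_normD _ _)); rewrite normrM.
apply: (le_trans (lerD (ler_wpM2l (normr_ge0 _) dE) mainz)).
rewrite le_eqVlt; apply/orP; left; apply/eqP; field.
by rewrite gt_eqF.
Qed.

(** With [B] and [C] the integrals of [b] and [b E], the function [E B - C] vanishes at [u] and has
    the continuous derivative [e B], hence is its integral; [B] itself may fail to be
    differentiable. *)
Lemma integration_by_parts_integrable u v b E e :
  mu.-integrable `[u, v] (EFin \o b) ->
  (forall x, `[u, v] x -> has_derivative_within `[u, v] E x (e x)) ->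
  {within `[u, v], continuous e} ->
  forall x, `[u, v] x ->
  E x * \int[mu]_(z in `[u, x]) b z =
  \int[mu]_(z in `[u, x]) (b z * E z + e z * \int[mu]_(w in `[u, z]) b w).
Proof.
move=> bi Ee ec x xuv.
have uv : u <= v by move: xuv; rewrite /= in_itv/= => /andP[/le_trans]; exact.
have [ux xv] : u <= x /\ x <= v by move: xuv; rewrite /= in_itv/= => /andP[].
have Ec := derivative_within_continuous Ee.
pose B y := \int[mu]_(z in `[u, y]) b z.
have Bc : {within `[u, v], continuous B}.
  exact: parameterized_integral_continuous.
have eBc : {within `[u, v], continuous (fun z => e z * B z)}.
  apply/subspace_continuousP => z zuv; apply: cvgM.
    by move/subspace_continuousP : ec; exact.
  by move/subspace_continuousP : Bc; exact.
have := Rintegral_derivative (derivative_within_integralM bi Ee ec) eBc xuv.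
rewrite set_itv1 !Rintegral_set1 mulr0 subrr subr0 -/(B x) => /eqP.
rewrite eq_sym subr_eq => /eqP ->; rewrite addrC -RintegralD//.
  by apply: integrable_itvS (integrableM_continuous bi Ec).
by apply: integrable_itvS (integrable_continuous_itv eBc).
Qed.

(** Lebesgue's differentiation theorem on the line, applied to the extension [g] of [f] by zero;
    near an interior point the two integrals coincide. *)
Lemma ae_derivative_integral u v f : mu.-integrable `[u, v] (EFin \o f) ->
  \forall x \ae mu, u < x < v ->
    is_derive x 1 (fun y => \int[mu]_(z in `[u, y]) f z) (f x).
Proof.
move=> fi; pose g := f \_ `[u, v].
have gi : mu.-integrable setT (EFin \o g).
  by rewrite /g -restrict_EFin; apply/(integrable_mkcond _ _).1.
have gl : locally_integrable setT g.
  by apply: open_integrable_locally => //; exact: openT.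
have gy y : mu.-integrable [set` Interval (BLeft u) (BRight y)] (EFin \o g).
  by apply: integrableS gi.
have := FTC1 gy gl.
apply: filterS; first exact: (ae_filter_ringOfSetsType mu).
move=> x /= gx /andP[ux xv].
have [] := gx _; first by rewrite lte_fin.
move=> /derivableP; rewrite -derive1E => + gE; rewrite gE.
have -> : g x = f x.
  by rewrite /g patchE mem_set//= in_itv/= !ltW.
have near_xv : \forall y \near x, y < v by exact: lt_nbhsl.
apply: near_eq_is_derive; near=> y; apply: eq_Rintegral => z.
rewrite inE/= in_itv/= => /andP[uz zy]; rewrite /g patchE mem_set//=.
by rewrite in_itv/= uz (le_trans zy)// ltW//; near: y.
Unshelve. all: by end_near. Qed.

Lemma ae_eq_Rintegral_itv u v f g :
  mu.-integrable `[u, v] (EFin \o f) -> mu.-integrable `[u, v] (EFin \o g) ->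
  (\forall x \ae mu, u < x < v -> f x = g x) ->
  \int[mu]_(z in `[u, v]) f z = \int[mu]_(z in `[u, v]) g z.
Proof.
move=> fi gi fg; rewrite /Rintegral; congr fine.
apply: ae_eq_integral => //; [exact: measurable_int fi|exact: measurable_int gi|].
have nu x0 : \forall x \ae mu, x != x0.
  exists [set x0]; split=> //; first exact: lebesgue_measure_set1.
  by move=> x /= /negP; rewrite negbK => /eqP.
have aeF := ae_filter_ringOfSetsType mu.
apply: filterS (filterI fg (filterI (nu u) (nu v))) => x /= [{}fg [xu xv]].
rewrite in_itv/= => /andP[ux xv'].
by rewrite fg// !lt_neqAle eq_sym xu ux xv xv'.
Qed.

End interval_integrals.

(** * Lebesgue measure under the dilation [z / c] *)

Section scaling.
Import measurable_realfun.
Context {R : realType}.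
Local Notation mu := (@lebesgue_measure R).
Variable c : R.
Hypothesis c0 : 0 < c.

Let phi : measurableTypeR R -> measurableTypeR R := fun z => z / c.

Let mphi : measurable_fun setT phi.
Proof.
apply: measurable_realfun.continuous_measurable_fun => x.
by apply: cvgM; [exact: cvg_id|exact: cvg_cst].
Qed.

Let nu : {measure set (measurableTypeR R) -> \bar R}.
Proof.
by refine [the {measure set (measurableTypeR R) -> \bar R} of
  pushforward mu phi]; exact: mphi.
Defined.

Let preimage_itv (b0 b1 : bool) (u v : R) :
  (phi @^-1` [set` Interval (BSide b0 u) (BSide b1 v)] =
   [set` Interval (BSide b0 (c * u)) (BSide b1 (c * v))])%classic.
Proof.
apply/seteqP; split=> z /=; rewrite !itv_boundlr /phi => /andP[];
  by case: b0; case: b1; rewrite !bnd_simp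
    ?ler_pdivlMr ?ler_pdivrMr ?ltr_pdivlMr ?ltr_pdivrMr ?[_ * c]mulrC// => -> ->.
Qed.

(** Divided by [c], the image measure [nu] gives every []a, b]] its length, and this characterizes
    Lebesgue measure. *)
Lemma lebesgue_measure_scale (A : set R) : measurable A ->
  mu ((fun z => z / c) @^-1` A) = (c%:E * mu A)%E.
Proof.
move=> mA; have ci0 : 0 <= c^-1 by rewrite invr_ge0 ltW.
have -> : mu A = (c^-1%:E * nu A)%E.
  have -> : (c^-1%:E * nu A)%E = mscale (NngNum ci0) nu A by [].
  apply: lebesgue_measure_unique => // _ [[a b]] _ <-.
  transitivity (c^-1%:E * mu (phi @^-1` `]a, b]))%E; last by [].
  rewrite preimage_itv !lebesgue_measure_itv/= !lte_fin ltr_pM2l//.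
  case: ifPn => _; last by rewrite mule0.
  by rewrite -!EFinD -EFinM -mulrBr mulKf// gt_eqF.
by rewrite muleA -EFinM mulfV ?gt_eqF// mul1e.
Qed.

(** Null sets of the similarity variable stay null in the space variable; this carries an equation
    known for almost every [eta] to almost every [x]. *)
Lemma ae_scale (P : set R) : (\forall x \ae mu, P x) ->
  \forall x \ae mu, P (x / c).
Proof.
move=> [N [mN N0 PN]]; exists (phi @^-1` N); split.
- by rewrite -[X in measurable X]setTI; exact: mphi.
- by rewrite lebesgue_measure_scale// N0 mule0.
- by move=> x /= Px; apply: PN.
Qed.

Let integral_nu (D : set (measurableTypeR R)) (f : measurableTypeR R -> \bar R) :
  measurable D -> measurable_fun D f -> (forall x, 0 <= f x)%E ->
  (\int[nu]_(x in D) f x = c%:E * \int[mu]_(x in D) f x)%E.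
Proof.
move=> mD mf f0; have cge0 : 0 <= c by exact: ltW.
rewrite -(ge0_integral_mscale mu mD (NngNum cge0) mf)//.
by apply: eq_measure_integral => A mA _; exact: lebesgue_measure_scale.
Qed.

(** [integral_nu] covers nonnegative functions, so positive and negative parts are scaled
    separately; integrability allows their recombination. *)
Let integral_scale (D : set (measurableTypeR R)) (f : measurableTypeR R -> \bar R) :
  measurable D -> measurable_fun setT f -> mu.-integrable D f ->
  mu.-integrable (phi @^-1` D) (f \o phi) /\
  (\int[mu]_(x in phi @^-1` D) (f \o phi) x = c%:E * \int[mu]_(x in D) f x)%E.
Proof.
move=> mD mf fi; have mfD : measurable_fun D f by exact: measurable_funS mf.
have mpD : measurable (phi @^-1` D).
  by rewrite -[X in measurable X]setTI; exact: mphi.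
have fphi : mu.-integrable (phi @^-1` D) (f \o phi).
  apply/integrableP; split.
    by apply: (@measurable_funS _ _ _ _ setT) => //; exact: measurableT_comp.
  rewrite -(ge0_integral_pushforward mphi mu (f := abse \o f) mD); last 2 first.
  - exact: measurableT_comp.
  - by move=> y _; exact: abse_ge0.
  rewrite (integral_nu mD _ (fun y => abse_ge0 (f y))); last first.
    exact: measurableT_comp.
  move/integrableP : fi => [_ foo].
  by apply: lte_mul_pinfty => //; rewrite lee_fin ltW.
split=> //; rewrite -(integral_pushforward mphi mf fphi mD).
rewrite integralE [X in _ = (_ * X)%E]integralE !integral_nu//; last 2 first.
- exact: measurable_funeneg.
- exact: measurable_funepos.
by apply/esym/muleBr => //; exact: integrable_add_def.
Qed.

Lemma Rintegral_scale (u v : R) (f : R -> R) :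
  mu.-integrable `[u / c, v / c] (EFin \o f) ->
  mu.-integrable `[u, v] (EFin \o (fun z => f (z / c))) /\
  \int[mu]_(z in `[u, v]) f (z / c) = c * \int[mu]_(z in `[u / c, v / c]) f z.
Proof.
move=> fi; pose D : set (measurableTypeR R) := `[u / c, v / c]%classic.
have mD : measurable D by exact: measurable_itv.
(* Cut off outside [D], the integrand becomes measurable on the whole line, as [integral_scale]
   requires. *)
pose g : measurableTypeR R -> \bar R := (EFin \o f) \_ D.
have gi : mu.-integrable D g.
  apply: (eq_integrable mD (EFin \o f)) => //.
  by move=> z zD; rewrite /g patchE zD.
have mg : measurable_fun setT g.
  by apply/(measurable_restrictT _ _).1 => //; exact: measurable_int fi.
have uvE : `[u, v]%classic = phi @^-1` D.
  by rewrite preimage_itv ![c * _]mulrC !divfK// gt_eqF.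
have [gphi gE] := integral_scale mD mg gi.
have gfE z : z \in (phi @^-1` D) -> (g \o phi) z = (f (z / c))%:E.
  by rewrite inE/= /g patchE => zD; rewrite mem_set.
have mpD : measurable (phi @^-1` D) by rewrite -uvE; exact: measurable_itv.
split.
  by rewrite uvE; apply: (eq_integrable mpD (g \o phi)).
rewrite /Rintegral uvE -(eq_integral _ _ gfE) gE.
have -> : (\int[mu]_(x in D) g x = \int[mu]_(x in D) (f x)%:E)%E.
  by apply: eq_integral => z zD; rewrite /g patchE zD.
by rewrite fineM//; exact: integrable_fin_num.
Qed.

End scaling.

(** * Error function and Kirchhoff's transformation *)

Section gaussian.
Context {R : realType}.
Local Notation mu := (@lebesgue_measure R).
Implicit Types (x y u v : R).

Lemma is_derive_sqr x : is_derive x 1 (fun z => z ^+ 2) (2 * x).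
Proof.
apply: DeriveDef; first exact: exprn_derivable.
by rewrite exp_derive expr1 /GRing.scale/= mulr1.
Qed.

Lemma is_derive_expR_sqr x :
  is_derive x 1 (fun z => expR (z ^+ 2)) (2 * x * expR (x ^+ 2)).
Proof.
have -> : 2 * x * expR (x ^+ 2) = expR (x ^+ 2) * (2 * x) by rewrite mulrC.
apply: (@is_derive1_comp _ expR (fun z => z ^+ 2)).
exact: is_derive_sqr.
Qed.

Lemma is_derive_expR_Nsqr x :
  is_derive x 1 (fun z => expR (- z ^+ 2)) (- (2 * x) * expR (- x ^+ 2)).
Proof.
have -> : - (2 * x) * expR (- x ^+ 2) = expR (- x ^+ 2) * - (2 * x).
  by rewrite mulrC.
apply: (@is_derive1_comp _ expR (fun z => - z ^+ 2)).
by apply: is_deriveN; exact: is_derive_sqr.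
Qed.

Lemma continuous_expR_sqr : continuous (fun x : R => expR (x ^+ 2)).
Proof.
move=> x; apply: differentiable_continuous; apply/derivable1_diffP.
by case: (is_derive_expR_sqr x).
Qed.

Lemma continuous_expR_Nsqr : continuous (fun x : R => expR (- x ^+ 2)).
Proof.
move=> x; apply: differentiable_continuous; apply/derivable1_diffP.
by case: (is_derive_expR_Nsqr x).
Qed.

Lemma expR_Nsqr_sqr x : expR (- x ^+ 2) * expR (x ^+ 2) = 1.
Proof. by rewrite -expRD addNr expR0. Qed.

Lemma sqrt_pi_gt0 : 0 < Num.sqrt (pi : R).
Proof. by rewrite sqrtr_gt0 pi_gt0. Qed.

Lemma erf0 : erf 0 = 0 :> R.
Proof. by rewrite /erf lexx set_itv1 Rintegral_set1 mulr0. Qed.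

Lemma derivative_within_erf v x : `[0, v] x ->
  has_derivative_within `[0, v] (@erf R) x
    (2 / Num.sqrt pi * expR (- x ^+ 2)).
Proof.
move=> xv; pose f y := \int[mu]_(z in `[0, y]) expR (- z ^+ 2).
have gc : {within `[0, v], continuous (fun z : R => expR (- z ^+ 2))}.
  exact: continuous_subspaceT continuous_expR_Nsqr.
apply: (@eq_derivative_within _ _ (fun y => 2 / Num.sqrt pi * f y)) => //.
  by move=> y; rewrite inE/= in_itv/= /erf => /andP[-> _].
apply: derivative_withinMl; apply: derivative_within_integral => //.
  exact: integrable_continuous_itv.
by move/subspace_continuousP : gc; exact.
Qed.

Lemma continuous_erf v : {within `[0, v], continuous (@erf R)}.
Proof. exact: derivative_within_continuous (@derivative_within_erf v). Qed.

Lemma erf_lt x y : 0 <= x -> x < y -> erf x < erf y.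
Proof.
move=> x0 xy.
have xy0 : `[x, y] `<=` `[0, y] by apply: subset_itvr; rewrite bnd_simp.
have [|c cxy E] := @MVT_within _ x y (@erf R)
    (fun z => 2 / Num.sqrt pi * expR (- z ^+ 2)) (ltW xy).
  by move=> z /xy0 z0; apply: derivative_withinS (derivative_within_erf z0).
rewrite -subr_gt0 E mulr_gt0 ?subr_gt0// mulr_gt0 ?expR_gt0//.
by rewrite divr_gt0// sqrt_pi_gt0.
Qed.

Lemma erf_gt0 x : 0 < x -> 0 < erf x.
Proof. by rewrite -{2}erf0; exact: erf_lt. Qed.

Lemma erf_ge0 x : 0 <= x -> 0 <= erf x.
Proof.
by rewrite le_eqVlt => /predU1P[<-|/erf_gt0/ltW//]; rewrite erf0.
Qed.

End gaussian.

(* Kirchhoff's transformation: it linearizes the flux, since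
   (kirchhoff y)' = (1 + delta y^p) y'. *)
Definition kirchhoff (R : realType) (delta p u : R) : R :=
  u * (1 + delta / (p + 1) * u `^ p).

Section kirchhoff.
Context {R : realType}.
Variables delta p : R.
Hypotheses (delta0 : 0 < delta) (p0 : 0 < p).
Implicit Types u v w : R.

Let k0 : 0 < delta / (p + 1).
Proof. by rewrite divr_gt0// addr_gt0. Qed.

Lemma kirchhoff0 : kirchhoff delta p 0 = 0.
Proof. by rewrite /kirchhoff mul0r. Qed.

Lemma kirchhoff1 : kirchhoff delta p 1 = 1 + delta / (p + 1).
Proof. by rewrite /kirchhoff powR1 mul1r mulr1. Qed.

(** What [kirchhoff] adds to the identity is a positive multiple of [u^(p+1)], nondecreasing on [[0,
    +oo[]. The expansion yields injectivity and replaces an inverse function theorem. *)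
Lemma kirchhoff_expand u v : `[0, +oo[ u -> `[0, +oo[ v ->
  `|u - v| <= `|kirchhoff delta p u - kirchhoff delta p v|.
Proof.
wlog uv : u v / u <= v => [H u0 v0|].
  have [uv|/ltW vu] := leP u v; first exact: H.
  by rewrite distrC [leRHS]distrC; exact: H.
rewrite /= !in_itv/= !andbT => u0 v0.
have upvp : u * u `^ p <= v * v `^ p.
  by rewrite ler_pM ?powR_ge0// ge0_ler_powR// ltW.
rewrite distrC [leRHS]distrC ger0_norm ?subr_ge0//.
apply: le_trans (ler_norm _); rewrite -subr_ge0 /kirchhoff.
have -> : v * (1 + delta / (p + 1) * v `^ p) - u * (1 + delta / (p + 1) * u `^ p)
    - (v - u) = delta / (p + 1) * (v * v `^ p - u * u `^ p) by ring.
by rewrite mulr_ge0 ?subr_ge0// ltW.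
Qed.

Lemma kirchhoff_inj u v : 0 <= u -> 0 <= v ->
  kirchhoff delta p u = kirchhoff delta p v -> u = v.
Proof.
move=> u0 v0 uv; apply/eqP; rewrite -subr_eq0 -normr_le0.
by rewrite (le_trans (kirchhoff_expand _ _))/= ?in_itv/= ?andbT// uv subrr normr0.
Qed.

(** At 0 the power need not be differentiable and is approached from the right only, so that case
    rests on [powR_cvg0]; elsewhere the power rule gives continuity. *)
Lemma cvg_within_powR u : 0 <= u ->
  @powR R ^~ p @ within `[0, +oo[ (nbhs u) --> u `^ p.
Proof.
rewrite le_eqVlt => /predU1P[<-|u0].
  rewrite powR0 ?gt_eqF//.
  have /cvgrPdist_le pc := powR_cvg0 p0; apply/cvg_withinP => e e0.
  have /nbhs_ballP[d /= d0 dp] := pc e e0.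
  exists d => // z; rewrite /= in_itv/= andbT le_eqVlt => /predU1P[<- _|z0].
    by rewrite /= powR0 ?gt_eqF// subrr normr0 ltW.
  by move=> zd; rewrite distrC; apply: dp => //; rewrite /ball/= distrC.
apply: cvg_within_filter.
have : {for u, continuous (@powR R ^~ p)}.
  apply: differentiable_continuous; apply/derivable1_diffP.
  by case: (is_derive1_powR p u0).
exact.
Qed.

Lemma derivative_within_kirchhoff u : 0 <= u ->
  has_derivative_within `[0, +oo[ (kirchhoff delta p) u (1 + delta * u `^ p).
Proof.
rewrite le_eqVlt => /predU1P[<-|u0].
  (* At 0 the difference quotient is exactly [1 + delta / (p + 1) z^p], which tends to 1 even when
     [p < 1]. *)
  rewrite powR0 ?gt_eqF// mulr0 addr0; apply/caratheodory_within.
  exists (fun u => 1 + delta / (p + 1) * u `^ p); split.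
  - by move=> z _; rewrite kirchhoff0 !subr0 /kirchhoff mulrC.
  - suff : (fun u => 1 + delta / (p + 1) * u `^ p) @ within `[0, +oo[ (nbhs (0 : R))
        --> 1 + delta / (p + 1) * 0 by rewrite mulr0 addr0.
    apply: cvgD; first exact: cvg_cst.
    apply: cvgM; first exact: cvg_cst.
    by have := cvg_within_powR (lexx 0); rewrite powR0 ?gt_eqF.
  - by rewrite powR0 ?gt_eqF// mulr0 addr0.
apply: is_derive_derivative_within; rewrite /kirchhoff.
have up : is_derive u 1 (@powR R ^~ p) (p * u `^ (p - 1)).
  exact: is_derive1_powR.
apply: is_derive_eq; rewrite /GRing.scale/=.
rewrite -(mulr_powRB1 (ltW u0) p0); field.
by rewrite gt_eqF// addr_gt0.
Qed.

Lemma kirchhoff_surj w : 0 <= w -> exists2 u, 0 <= u & kirchhoff delta p u = w.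
Proof.
move=> w0; have kw : w <= kirchhoff delta p w.
  by rewrite /kirchhoff ler_peMr// lerDl mulr_ge0 ?powR_ge0// ltW.
have kc : {within `[0, w], continuous (kirchhoff delta p)}.
  apply: (@derivative_within_continuous _ _ _ (fun u => 1 + delta * u `^ p)).
  move=> u; rewrite /= in_itv/= => /andP[u0 _].
  apply: derivative_withinS (derivative_within_kirchhoff u0).
  by move=> z /=; rewrite !in_itv/= andbT => /andP[].
have [|u] := IVT w0 kc (v := w).
  by rewrite kirchhoff0 ge_min w0/= le_max kw orbT.
by rewrite in_itv/= => /andP[u0 _]; exists u.
Qed.

End kirchhoff.

(** * The functional problem *)

Definition source_integral (R : realType) (beta : R -> R) (x : R) : R :=
  \int[lebesgue_measure]_(xi in `[0, x]) (beta xi * expR (xi ^+ 2)).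

(** The right-hand side of [profile_equation], whose left-hand side is [kirchhoff delta p (y eta)];
    the two forms agree by unfolding and are interchanged silently. *)
Definition profile_rhs (R : realType) (delta p Ste : R) (beta : R -> R)
    (lambda eta : R) : R :=
  1 + delta / (p + 1)
  - Num.sqrt pi * erf eta / Ste *
    (2 * source_integral beta lambda + lambda * expR (lambda ^+ 2))
  + 2 * Num.sqrt pi / Ste *
    (\int[lebesgue_measure]_(xi in `[0, eta])
       (beta xi * expR (xi ^+ 2) * (erf eta - erf xi))).

(** The derivative of [profile_rhs] in [eta], that is [G']. Its constant term is the one that gives
    [- 2 lambda / Ste] at [eta = lambda], as the Stefan condition demands. *)
Definition profile_slope (R : realType) (Ste : R) (beta : R -> R)
    (lambda eta : R) : R :=
  2 / Ste * expR (- eta ^+ 2) *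
  (2 * source_integral beta eta
   - (2 * source_integral beta lambda + lambda * expR (lambda ^+ 2))).

(** * The source and the right-hand side of the profile equation *)

Section source.
Context {R : realType}.
Local Notation mu := (@lebesgue_measure R).
Variable beta : R -> R.
Hypotheses (beta_ge0 : forall eta, 0 < eta -> 0 <= beta eta)
  (beta_int0 : forall epsilon, 0 < epsilon ->
     mu.-integrable `]0, epsilon[ (EFin \o beta)).
Implicit Types (x y v lambda : R).

Local Notation Q := (source_integral beta).

(** The assumption concerns open intervals []0, epsilon[]. The end [v] is reached from []0, v + 1[],
    and adjoining 0, where nothing is known of [beta], adds a null set. *)
Lemma integrable_source v : mu.-integrable `[0, v] (EFin \o beta).
Proof.
have [v0|v0] := ltP v 0.
  rewrite set_itv_ge; last by rewrite bnd_simp -ltNge.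
  exact: integrable_set0.
have bi : mu.-integrable `]0, v] (EFin \o beta).
  have v1 : 0 < v + 1 by rewrite ltr_wpDl.
  apply: integrableS (beta_int0 v1) => // z /=.
  by rewrite !in_itv/= => /andP[-> zv]; rewrite (le_lt_trans zv)// ltrDl.
have N0 : mu [set 0 : R] = 0%E by exact: lebesgue_measure_set1.
have D0 : `[0, v] `\` [set 0] = `]0, v]%classic.
  apply/seteqP; split => z /=; rewrite !in_itv/=.
    by move=> [/andP[z0 ->] /eqP zN0]; rewrite lt_neqAle eq_sym zN0 z0.
  by move=> /andP[z0 ->]; rewrite (ltW z0); split=> //; apply/eqP; rewrite gt_eqF.
have [//|//||_] := @negligible_integrable _ _ R mu `[0, v]%classic
  [set (0 : R)] (EFin \o beta) _ _ _ N0; last by rewrite D0; exact.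
apply/measurable_realfun.measurable_EFinP.
apply/measurable_realfun.measurable_fun_itv_obnd_cbndP.
by apply/measurable_realfun.measurable_EFinP; exact: measurable_int bi.
Qed.

Lemma integrable_sourceM v f : {within `[0, v], continuous f} ->
  mu.-integrable `[0, v] (EFin \o (fun z => beta z * f z)).
Proof. by move=> fc; exact: integrableM_continuous (integrable_source v) fc. Qed.

Lemma integrable_source_expR v :
  mu.-integrable `[0, v] (EFin \o (fun z => beta z * expR (z ^+ 2))).
Proof.
exact: integrable_sourceM (continuous_subspaceT (@continuous_expR_sqr R)).
Qed.

Lemma source_integral_le x y : 0 <= x -> x <= y -> Q x <= Q y.
Proof.
move=> x0 xy; rewrite -subr_ge0 /source_integral Rintegral_itvB ?bnd_simp//.
  apply: Rintegral_ge0 => z; rewrite /= in_itv/= => /andP[xz _].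
  by rewrite mulr_ge0 ?expR_ge0// beta_ge0// (le_lt_trans x0).
exact: integrable_source_expR.
Qed.

Lemma continuous_source_integral v : 0 <= v -> {within `[0, v], continuous Q}.
Proof.
by move=> v0; exact: parameterized_integral_continuous (integrable_source_expR v).
Qed.

Section profile.
Variables delta p Ste : R.
Hypothesis Ste0 : 0 < Ste.

Local Notation rhs := (profile_rhs delta p Ste beta).
Local Notation slope := (profile_slope Ste beta).

Lemma profile_rhs0 lambda : rhs lambda 0 = 1 + delta / (p + 1).
Proof.
by rewrite /profile_rhs erf0 set_itv1 Rintegral_set1 !mulr0 !mul0r subr0 addr0.
Qed.

(** Expanding [erf x - erf xi] takes [x] out of the integrand and produces the combination treated
    by [derivative_within_integralM], with [erf] for [E] and [beta exp(xi^2)] for [b]. *)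
Let rhsE lambda x : 0 <= x -> rhs lambda x =
  1 + delta / (p + 1)
  - Num.sqrt pi / Ste * (2 * Q lambda + lambda * expR (lambda ^+ 2)) * erf x
  + 2 * Num.sqrt pi / Ste * (erf x * Q x -
    \int[mu]_(xi in `[0, x]) (beta xi * expR (xi ^+ 2) * erf xi)).
Proof.
move=> x0; rewrite /profile_rhs; congr (_ - _ + _ * _); first by ring.
have qi := integrable_source_expR x.
rewrite -RintegralZl// -RintegralB//.
- by apply: eq_Rintegral => z _; ring.
- rewrite (_ : _ \o _ =
    (fun z => (erf x)%:E * (beta z * expR (z ^+ 2))%:E)%E)//.
  exact: integrableZl.
- by apply: integrableM_continuous => //; exact: continuous_erf.
Qed.

Lemma derivative_within_profile_rhs lambda x : `[0, lambda] x ->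
  has_derivative_within `[0, lambda] (rhs lambda) x (slope lambda x).
Proof.
move=> xl; pose K := 2 * Q lambda + lambda * expR (lambda ^+ 2).
have gc : {within `[0, lambda], continuous
    (fun z : R => 2 / Num.sqrt pi * expR (- z ^+ 2))}.
  apply: continuous_subspaceT => z.
  by apply: cvgM; [exact: cvg_cst|exact: continuous_expR_Nsqr].
have Dx := derivative_within_integralM (integrable_source_expR lambda)
  (@derivative_within_erf R lambda) gc xl.
have Ex := derivative_within_erf xl.
have := derivative_withinD
  (derivative_withinB (derivative_within_cst `[0, lambda] (1 + delta / (p + 1)) x)
    (derivative_withinMl (c := Num.sqrt pi / Ste * K) Ex))
  (derivative_withinMl (c := 2 * Num.sqrt pi / Ste) Dx).
have -> : 0 - Num.sqrt pi / Ste * K * (2 / Num.sqrt pi * expR (- x ^+ 2)) +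
    2 * Num.sqrt pi / Ste * (2 / Num.sqrt pi * expR (- x ^+ 2) *
      \int[mu]_(z in `[0, x]) (beta z * expR (z ^+ 2))) = slope lambda x.
  rewrite /profile_slope -/K -/(source_integral beta x); field.
  by rewrite !gt_eqF// sqrt_pi_gt0.
apply: eq_derivative_within => // y.
by rewrite inE/= in_itv/= => /andP[y0 _]; rewrite rhsE.
Qed.

(** At [eta = lambda] the two terms in [erf lambda] times [Q lambda] cancel, leaving
    [1 + delta / (p + 1)] minus the left-hand side of the front equation. *)
Lemma front_equationE lambda : 0 <= lambda ->
  front_equation delta p Ste beta lambda <-> rhs lambda lambda = 0.
Proof.
move=> l0; rewrite rhsE// /front_equation.
have -> : \int[mu]_(xi in `[0, lambda]) (expR (xi ^+ 2) * erf xi * beta xi) =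
    \int[mu]_(xi in `[0, lambda]) (beta xi * expR (xi ^+ 2) * erf xi).
  by apply: eq_Rintegral => z _; ring.
set J := \int[mu]_(xi in _) _.
by split=> H; [rewrite -H|apply/eqP; rewrite eq_sym -subr_eq0 -H; apply/eqP]; ring.
Qed.

Lemma continuous_profile_slope lambda : 0 <= lambda ->
  {within `[0, lambda], continuous (slope lambda)}.
Proof.
move=> l0; apply/subspace_continuousP => x xl.
apply: cvgM; first apply: cvgM.
- exact: cvg_cst.
- by apply: cvg_within_filter; exact: continuous_expR_Nsqr.
- apply: cvgB; last exact: cvg_cst.
  apply: cvgM; first exact: cvg_cst.
  by have /subspace_continuousP := continuous_source_integral l0; exact.
Qed.

(** [Q] is nondecreasing because [beta] is nonnegative, and the term [lambda exp(lambda^2)] makes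
    the inequality strict. *)
Lemma profile_slope_lt0 lambda x : 0 < lambda -> 0 <= x <= lambda ->
  slope lambda x < 0.
Proof.
move=> l0 /andP[x0 xl]; rewrite /profile_slope pmulr_rlt0.
  rewrite subr_lt0 (@le_lt_trans _ _ (2 * Q lambda))//.
    by rewrite ler_pM2l// source_integral_le.
  by rewrite ltrDl mulr_gt0// expR_gt0.
by rewrite mulr_gt0 ?expR_gt0// divr_gt0.
Qed.

Lemma profile_rhs_lt lambda x y : 0 < lambda -> 0 <= x -> x < y -> y <= lambda ->
  rhs lambda y < rhs lambda x.
Proof.
move=> l0 x0 xy yl.
have xyl : `[x, y] `<=` `[0, lambda] by apply: subset_itv; rewrite bnd_simp.
have [|c cxy E] := @MVT_within _ x y (rhs lambda) (slope lambda) (ltW xy).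
  move=> z /xyl zl.
  by apply: derivative_withinS (derivative_within_profile_rhs zl).
rewrite -subr_lt0 E nmulr_rlt0 ?subr_gt0//.
by apply: profile_slope_lt0 => //; exact: xyl.
Qed.

End profile.

(** * The front equation *)

Section front.
Variables delta p Ste : R.
Hypotheses (delta0 : 0 < delta) (p0 : 0 < p) (Ste0 : 0 < Ste).

Let J x := \int[mu]_(xi in `[0, x]) (expR (xi ^+ 2) * erf xi * beta xi).

Let front x := Num.sqrt pi / Ste * x * erf x * expR (x ^+ 2) +
  2 * Num.sqrt pi / Ste * J x.

Let integrable_J v :
  mu.-integrable `[0, v] (EFin \o (fun z => expR (z ^+ 2) * erf z * beta z)).
Proof.
have : mu.-integrable `[0, v]
    (EFin \o (fun z => beta z * (expR (z ^+ 2) * erf z))).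
  apply: integrable_sourceM; apply/subspace_continuousP => x xv.
  apply: cvgM; first by apply: cvg_within_filter; exact: continuous_expR_sqr.
  by have /subspace_continuousP := @continuous_erf R v; exact.
apply: eq_integrable => // z _.
by rewrite /= mulrC.
Qed.

Let J_le x y : 0 <= x -> x <= y -> J x <= J y.
Proof.
move=> x0 xy; rewrite -subr_ge0 /J Rintegral_itvB ?bnd_simp//.
  apply: Rintegral_ge0 => z; rewrite /= in_itv/= => /andP[xz _].
  have z0 := le_lt_trans x0 xz.
  by rewrite mulr_ge0 ?beta_ge0// mulr_ge0 ?expR_ge0 ?erf_ge0// ltW.
Qed.

Let c0 : 0 < Num.sqrt pi / Ste.
Proof. by rewrite divr_gt0// sqrt_pi_gt0. Qed.

Let front_lt x y : 0 <= x -> x < y -> front x < front y.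
Proof.
move=> x0 xy; have y0 := le_lt_trans x0 xy.
rewrite /front ltr_leD//; last first.
  by rewrite ler_wpM2l ?(J_le _ (ltW _))// -mulrA mulr_ge0// ltW.
have xe : x * erf x < y * erf y.
  by apply: ltr_pM => //; [exact: erf_ge0|exact: erf_lt].
have mE z : Num.sqrt pi / Ste * z * erf z * expR (z ^+ 2) =
    Num.sqrt pi / Ste * (z * erf z * expR (z ^+ 2)) by rewrite !mulrA.
rewrite !mE ltr_pM2l//; apply: ltr_pM => //; rewrite ?expR_ge0//.
  by rewrite mulr_ge0// erf_ge0.
by rewrite ltr_expR ltr_pXn2r// nnegrE ltW.
Qed.

Lemma front_equation_unique x y : 0 < x -> 0 < y ->
  front_equation delta p Ste beta x -> front_equation delta p Ste beta y ->
  x = y.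
Proof.
rewrite /front_equation -/(J x) -/(J y) -/(front x) -/(front y).
move=> x0 y0 fx fy; have fxy : front x = front y by rewrite fx fy.
have [xy|yx|//] := ltgtP x y.
  by have := front_lt (ltW x0) xy; rewrite fxy ltxx.
by have := front_lt (ltW y0) yx; rewrite fxy ltxx.
Qed.

Lemma front_equation_exists :
  exists2 x, 0 < x & front_equation delta p Ste beta x.
Proof.
have k0 : 0 < 1 + delta / (p + 1) by rewrite addr_gt0// divr_gt0// addr_gt0.
pose c := Num.sqrt pi / Ste * erf 1.
have cpos : 0 < c by rewrite mulr_gt0// erf_gt0.
(* For [M >= 1] the first term of [front M] is at least [M * c], since [erf M >= erf 1] and
   [exp(M^2) >= 1]; this choice gives [M * c = c + 1 + delta / (p + 1)]. *)
pose M := 1 + (1 + delta / (p + 1)) / c.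
have M1 : 1 <= M by rewrite lerDl divr_ge0// ltW.
have M0 : 0 <= M by rewrite (le_trans _ M1).
have front0 : front 0 = 0.
  by rewrite /front /J set_itv1 Rintegral_set1 !(mulr0, mul0r) addr0.
have frontM : 1 + delta / (p + 1) <= front M.
  have J0 : 0 <= J M by rewrite -[leLHS](_ : J 0 = 0) ?J_le// /J set_itv1 Rintegral_set1.
  apply: (@le_trans _ _ (M * c)).
    by rewrite mulrDl divfK ?gt_eqF// lerDr mul1r ltW.
  rewrite /front -[leLHS]addr0 lerD//; last first.
    by rewrite mulr_ge0// -mulrA mulr_ge0// ltW.
  have -> : M * c = Num.sqrt pi / Ste * (M * (erf 1 * 1)) by rewrite /c; ring.
  have -> : Num.sqrt pi / Ste * M * erf M * expR (M ^+ 2) =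
      Num.sqrt pi / Ste * (M * (erf M * expR (M ^+ 2))) by rewrite !mulrA.
  rewrite ler_pM2l// ler_wpM2l// ler_pM ?erf_ge0//.
    by move: M1; rewrite le_eqVlt => /predU1P[<-//|/(erf_lt ler01)/ltW].
  rewrite (le_trans _ (expR_ge1Dx _))// lerDl.
  by rewrite sqr_ge0.
have fc : {within `[0, M], continuous front}.
  have Jc : {within `[0, M], continuous J}.
    exact: parameterized_integral_continuous (integrable_J M).
  apply/subspace_continuousP => x xM; apply: cvgD.
    apply: cvgM; last by apply: cvg_within_filter; exact: continuous_expR_sqr.
    apply: cvgM; last by have /subspace_continuousP := @continuous_erf R M; exact.
    by apply: cvgM; [exact: cvg_cst|apply: cvg_within_filter; exact: cvg_id].
  apply: cvgM; first exact: cvg_cst.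
  by move/subspace_continuousP : Jc; exact.
have [|x] := IVT M0 fc (v := 1 + delta / (p + 1)).
  by rewrite front0 ge_min (ltW k0)/= le_max frontM orbT.
rewrite in_itv/= => /andP[x0 xM] fx; exists x => //.
rewrite lt_neqAle x0 andbT; apply/eqP => x0'.
by move: k0; rewrite -fx -x0' front0 ltxx.
Qed.

End front.
End source.

(** * Regularity of the profile and well-posedness of the functional problem *)

Section functional_problem.
Context {R : realType}.
Local Notation mu := (@lebesgue_measure R).
Variables (beta : R -> R) (delta p Ste : R).
Hypotheses (beta_ge0 : forall eta, 0 < eta -> 0 <= beta eta)
  (beta_int0 : forall epsilon, 0 < epsilon ->
     mu.-integrable `]0, epsilon[ (EFin \o beta)).
Hypotheses (delta0 : 0 < delta) (p0 : 0 < p) (Ste0 : 0 < Ste).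

Local Notation rhs := (profile_rhs delta p Ste beta).
Local Notation slope := (profile_slope Ste beta).

Section profile_regularity.
Variables (lambda : R) (y : R -> R).
Hypotheses (lambda0 : 0 < lambda)
  (y_ge0 : forall eta, 0 <= eta <= lambda -> 0 <= y eta)
  (yE : forall eta, 0 <= eta <= lambda ->
     kirchhoff delta p (y eta) = rhs lambda eta).

Let dy eta := slope lambda eta / (1 + delta * y eta `^ p).

Let den0 eta : 0 < 1 + delta * y eta `^ p.
Proof. by rewrite ltr_wpDr// mulr_ge0 ?powR_ge0// ltW. Qed.

(** [y] is known only through [kirchhoff \o y], which has the derivative of [profile_rhs]. At a zero
    of [y] the one-sided derivative of [kirchhoff] on [[0, +oo[] is enough. *)
Lemma derivative_within_profile eta : `[0, lambda] eta ->
  has_derivative_within `[0, lambda] y eta (dy eta).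
Proof.
move=> etal; apply: (@derivative_within_inverse _ _ `[0, +oo[ _
    (kirchhoff delta p)) => //.
- by move=> z; rewrite /= !in_itv/= andbT; exact: y_ge0.
- by move=> z w; exact: kirchhoff_expand.
- by rewrite gt_eqF.
- by apply: derivative_within_kirchhoff => //; apply: y_ge0.
- apply: (eq_derivative_within etal _ (derivative_within_profile_rhs
    beta_int0 delta p Ste0 etal)).
  by move=> z; rewrite inE/= in_itv/= => /yE.
Qed.

Let cvg_powR_y D eta : D `<=` `[0, lambda] -> D eta ->
  has_derivative_within D y eta (dy eta) ->
  (fun z => y z `^ p) @ within D (nbhs eta) --> y eta `^ p.
Proof.
move=> Dl etal /derivative_within_cvg yc.
have y0 z : D z -> 0 <= y z by move=> /Dl; rewrite /= in_itv/=; exact: y_ge0.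
apply: (cvg_within_comp (E := `[0, +oo[) _ yc (cvg_within_powR p0 (y0 _ etal))).
by move=> z /y0; rewrite /= in_itv/= andbT.
Qed.

Lemma profile_C1 : C1_on `[0, lambda] y.
Proof.
exists dy; split; first exact: derivative_within_profile.
apply/subspace_continuousP => eta etal; apply: cvgM.
  have /subspace_continuousP := @continuous_profile_slope _ _ beta_int0 Ste lambda
    (ltW lambda0).
  exact.
apply: cvgV; first by rewrite gt_eqF.
apply: cvgD; first exact: cvg_cst.
apply: cvgM; first exact: cvg_cst.
exact: cvg_powR_y (derivative_within_profile etal).
Qed.

(** A zero before [lambda] would make the strictly decreasing [rhs lambda] negative at [lambda],
    where it is [kirchhoff] of a nonnegative number. *)
Lemma profile_gt0 eta : 0 <= eta -> eta < lambda -> 0 < y eta.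
Proof.
move=> eta0 etal; have etal' : 0 <= eta <= lambda by rewrite eta0 ltW.
rewrite lt_neqAle y_ge0// andbT; apply/eqP => y0.
have := profile_rhs_lt beta_ge0 beta_int0 delta p Ste0 lambda0 eta0 etal (lexx _).
have ll : 0 <= lambda <= lambda by rewrite lexx ltW.
rewrite -!yE// -y0 kirchhoff0 ltNge /kirchhoff mulr_ge0 ?y_ge0//.
by rewrite addr_ge0// mulr_ge0 ?powR_ge0// divr_ge0 ?addr_ge0 ?ltW.
Qed.

(** [beta] is smooth on [[u, v]] only, while the integral starts at 0; the part up to [u] is a
    constant. *)
Lemma n_times_derivable_source_integral u v n : 0 <= u -> u < v -> v <= lambda ->
  Coo_on `[u, v] beta ->
  n_times_derivable `[u, v] n (source_integral beta).
Proof.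
move=> u0 uv vl /(Coo_onP _ uv) betaoo; pose q z := beta z * expR (z ^+ 2).
have qoo m : n_times_derivable `[u, v] m q.
  apply: n_times_derivableM => //; apply: n_times_derivable_expR.
  by apply: n_times_derivableX; exact: n_times_derivable_id.
case: n => // n; exists q => // x xuv.
have qv : mu.-integrable `[0, v] (EFin \o q) by exact: integrable_source_expR.
have quv : mu.-integrable `[u, v] (EFin \o q) by exact: integrable_itvS qv.
have [q' qq' _] := qoo 1%N.
have := derivative_withinD
  (derivative_within_cst `[u, v] (source_integral beta u) x)
  (derivative_within_integral quv xuv (derivative_within_cvg (qq' x xuv))).
rewrite add0r; apply: eq_derivative_within => // z.
rewrite inE/= in_itv/= => /andP[uz zv]; rewrite /source_integral.
by rewrite -(Rintegral_chasles u0 uz)//; exact: integrable_itvS qv.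
Qed.

(** Bootstrap: [y' = slope / (1 + delta y^p)], so [n] derivatives of [y] give [n + 1]. The power
    preserves smoothness because [y > 0] on [[u, v]] when [v < lambda], and because it is a product
    of copies of [y] when [p] is an integer. *)
Lemma profile_Coo u v : 0 <= u -> u < v -> v <= lambda ->
  Coo_on `[u, v] beta -> v < lambda \/ (exists n : nat, p = n%:R) ->
  Coo_on `[u, v] y.
Proof.
move=> u0 uv vl betaoo vp; apply/(Coo_onP _ uv).
have uvl : `[u, v] `<=` `[0, lambda] by apply: subset_itv; rewrite bnd_simp.
have slopeoo n : n_times_derivable `[u, v] n (slope lambda).
  apply: n_times_derivableM; first apply: n_times_derivableM.
  - exact: n_times_derivable_cst.
  - apply: n_times_derivable_expR; apply: n_times_derivableN.
    by apply: n_times_derivableX; exact: n_times_derivable_id.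
  - apply: n_times_derivableD; last exact: n_times_derivable_cst.
    apply: n_times_derivableM; first exact: n_times_derivable_cst.
    exact: n_times_derivable_source_integral.
have yp n : n_times_derivable `[u, v] n y ->
    n_times_derivable `[u, v] n (fun x => y x `^ p).
  move=> yn; case: vp => [vl'|[k pk]].
    apply: n_times_derivable_powR => // x; rewrite /= in_itv/= => /andP[ux xv].
    by apply: profile_gt0; [exact: le_trans ux|exact: le_lt_trans vl'].
  apply: (@eq_n_times_derivable _ _ _ (fun x => y x ^+ k)).
    move=> x; rewrite inE => /uvl; rewrite /= in_itv/= => /y_ge0 yx.
    by rewrite pk powR_mulrn.
  exact: n_times_derivableX.
elim=> // n yn; exists dy.
  by move=> x xuv; apply: derivative_withinS (derivative_within_profile _) => //;
    exact: uvl.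
apply: n_times_derivableM => //; apply: n_times_derivableV.
  by move=> x _; rewrite gt_eqF.
apply: n_times_derivableD; first exact: n_times_derivable_cst.
apply: n_times_derivableM; first exact: n_times_derivable_cst.
exact: yp.
Qed.

End profile_regularity.

Lemma functional_problem_exists :
  exists lambda y, functional_problem delta p Ste beta lambda y.
Proof.
have [lambda l0 fl] := front_equation_exists beta_ge0 beta_int0 delta0 p0 Ste0.
have rl := (front_equationE beta_int0 delta p Ste (ltW l0)).1 fl.
have rhs_ge0 eta : 0 <= eta <= lambda -> 0 <= rhs lambda eta.
  move=> /andP[eta0]; rewrite -[X in _ -> X <= _]rl le_eqVlt.
  move=> /predU1P[->//|etal]; apply: ltW.
  exact: (profile_rhs_lt beta_ge0 beta_int0 delta p Ste0).
(* Outside [[0, lambda]] the requirement is vacuous and the chosen [y] is arbitrary. *)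
have /choice[y yE] eta : exists z, 0 <= eta <= lambda ->
    0 <= z /\ kirchhoff delta p z = rhs lambda eta.
  have [etal|] := boolP (0 <= eta <= lambda); last by exists 0.
  by have [z z0 zE] := kirchhoff_surj delta0 p0 (rhs_ge0 _ etal); exists z.
have y0 eta : 0 <= eta <= lambda -> 0 <= y eta by move=> /yE[].
have {}yE eta : 0 <= eta <= lambda -> kirchhoff delta p (y eta) = rhs lambda eta.
  by move=> /yE[].
exists lambda, y; split=> //; split=> //.
- exact: profile_C1.
- exact: profile_Coo.
Qed.

Lemma functional_problem_unique lambda lambda' (y y' : R -> R) :
  functional_problem delta p Ste beta lambda y ->
  functional_problem delta p Ste beta lambda' y' ->
  lambda' = lambda /\ (forall eta, 0 <= eta <= lambda -> y' eta = y eta).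
Proof.
move=> [[l0 y0 _ _] fl yE] [[l'0 y'0 _ _] fl' y'E].
have ll : lambda' = lambda.
  exact: (front_equation_unique beta_ge0 beta_int0 Ste0 l'0 l0 fl' fl).
subst lambda'; split=> // eta etal.
apply: (kirchhoff_inj delta0 p0); [exact: y'0|exact: y0|].
transitivity (rhs lambda eta); first exact: y'E.
by apply/esym; exact: yE.
Qed.

End functional_problem.

(** * The linear equation for the slope, pointwise and integrated *)

Section slope_equation.
Context {R : realType}.
Local Notation mu := (@lebesgue_measure R).
Variables (beta : R -> R) (Ste : R).
Hypotheses (beta_int0 : forall epsilon, 0 < epsilon ->
     mu.-integrable `]0, epsilon[ (EFin \o beta)).
Implicit Types lambda u x : R.

Local Notation Q := (source_integral beta).
Local Notation slope := (profile_slope Ste beta).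

(** This is [G'' = 4 beta / Ste - 2 eta G']. The hypothesis will be met at almost every positive
    point, and at every positive point where [beta] is continuous. *)
Lemma is_derive_profile_slope lambda x :
  is_derive x 1 Q (beta x * expR (x ^+ 2)) ->
  is_derive x 1 (slope lambda) (4 / Ste * beta x - 2 * x * slope lambda x).
Proof.
move=> Qx; rewrite /profile_slope; set K := _ + lambda * _.
have Ex := is_derive_expR_Nsqr x.
apply: is_derive_eq; rewrite /GRing.scale/=.
have E1 := expR_Nsqr_sqr x; set E := expR (- x ^+ 2) in E1 *.
have -> : 4 / Ste * beta x = 4 / Ste * beta x * (E * expR (x ^+ 2)).
  by rewrite E1 mulr1.
ring.
Qed.

Lemma integrable_slope_equation lambda : 0 <= lambda ->
  mu.-integrable `[0, lambda]
    (EFin \o (fun x => 4 / Ste * beta x - 2 * x * slope lambda x)).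
Proof.
move=> l0; rewrite (_ : _ \o _ = (fun x => (4 / Ste)%:E * (beta x)%:E -
    (2 * x * slope lambda x)%:E)%E)//.
apply: integrableB => //.
  by apply: integrableZl => //; exact: integrable_source.
apply: (@integrable_continuous_itv _ _ _ (fun x => 2 * x * slope lambda x)).
apply/subspace_continuousP => x xl; apply: cvgM.
  by apply: cvgM; [exact: cvg_cst|apply: cvg_within_filter; exact: cvg_id].
have /subspace_continuousP :=
  continuous_profile_slope beta_int0 (Ste := Ste) l0.
exact.
Qed.

(** The derivative of [slope] is available almost everywhere only, so the increments come from
    integrating [exp(- z^2)] by parts against the merely integrable source. *)
Lemma profile_slope_integral lambda u x : 0 <= u -> u <= x -> x <= lambda ->
  slope lambda x - slope lambda u =
  \int[mu]_(z in `[u, x]) (4 / Ste * beta z - 2 * z * slope lambda z).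
Proof.
pose h z := 4 / Ste * beta z - 2 * z * slope lambda z.
have main y : 0 <= y -> y <= lambda ->
    slope lambda y = slope lambda 0 + \int[mu]_(z in `[0, y]) h z.
  move=> y0 yl; have l0 := le_trans y0 yl.
  have yl' : `[0, lambda] y by rewrite /= in_itv/= y0.
  pose K := 2 * Q lambda + lambda * expR (lambda ^+ 2).
  pose E z : R := expR (- z ^+ 2); pose e z : R := - (2 * z) * expR (- z ^+ 2).
  have Ee z : `[0, lambda] z -> has_derivative_within `[0, lambda] E z (e z).
    move=> _; apply: is_derive_derivative_within.
    exact: is_derive_expR_Nsqr.
  have ec : {within `[0, lambda], continuous e}.
    apply: continuous_subspaceT => z; apply: cvgM; last exact: continuous_expR_Nsqr.
    by apply: cvgN; apply: cvgM; [exact: cvg_cst|exact: cvg_id].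
  have qi := integrable_source_expR beta_int0 lambda.
  have ibp := integration_by_parts_integrable qi Ee ec yl'.
  have ie := Rintegral_derivative Ee ec yl'.
  have hi : mu.-integrable `[0, y] (EFin \o
      (fun z => beta z * expR (z ^+ 2) * E z + e z * Q z)).
    rewrite (_ : _ \o _ = (fun z => (beta z * expR (z ^+ 2) * E z)%:E +
      (e z * Q z)%:E)%E)//.
    apply: integrableD => //.
      apply: integrable_itvS (lexx 0) yl _.
      apply: integrableM_continuous => //.
      exact: derivative_within_continuous Ee.
    apply: integrable_itvS (lexx 0) yl _.
    apply: integrable_continuous_itv; apply/subspace_continuousP => z zl.
    apply: cvgM; first by move/subspace_continuousP : ec; exact.
    have /subspace_continuousP := continuous_source_integral beta_int0 l0.
    exact.
  have ei : mu.-integrable `[0, y] (EFin \o e).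
    by apply: integrable_itvS (lexx 0) yl _; exact: integrable_continuous_itv.
  (* The integrand is regrouped into that of the integration by parts and a multiple of [e], the
     derivative of [exp(- z^2)]. *)
  have -> : \int[mu]_(z in `[0, y]) h z =
     \int[mu]_(z in `[0, y]) (2 / Ste * 2 * (beta z * expR (z ^+ 2) * E z + e z * Q z)
       - 2 / Ste * K * e z).
    apply: eq_Rintegral => z _; rewrite /h /profile_slope -/K /e.
    have E1 := expR_Nsqr_sqr z; rewrite /E.
    have -> : 4 / Ste * beta z = 4 / Ste * beta z * (expR (- z ^+ 2) * expR (z ^+ 2)).
      by rewrite E1 mulr1.
    ring.
  rewrite RintegralB//; last 2 first.
  - rewrite (_ : _ \o _ = (fun z => (2 / Ste * 2)%:E *
      (beta z * expR (z ^+ 2) * E z + e z * Q z)%:E)%E)//.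
    exact: integrableZl.
  - rewrite (_ : _ \o _ = (fun z => (2 / Ste * K)%:E * (e z)%:E)%E)//.
    exact: integrableZl.
  rewrite !RintegralZl// -ibp ie /profile_slope -/K /E -/(source_integral beta y).
  have -> : Q 0 = 0 by rewrite /source_integral set_itv1 Rintegral_set1.
  by ring.
move=> u0 ux xl; have x0 := le_trans u0 ux; have l0 := le_trans x0 xl.
have hi := integrable_slope_equation l0.
rewrite (main x x0 xl) (main u u0 (le_trans ux xl)) (Rintegral_chasles u0 ux).
  by ring.
exact: integrable_itvS hi.
Qed.

Lemma ae_derivative_source_integral lambda :
  \forall x \ae mu, 0 < x < lambda ->
    is_derive x 1 Q (beta x * expR (x ^+ 2)).
Proof. exact: ae_derivative_integral (integrable_source_expR beta_int0 lambda). Qed.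

Lemma derivative_source_integral x : 0 < x -> {for x, continuous beta} ->
  is_derive x 1 Q (beta x * expR (x ^+ 2)).
Proof.
move=> x0 bx; have xv : 0 < x < x + 1 by rewrite x0 ltrDl ltr01.
apply: (derivative_within_itv_is_derive xv).
apply: (@derivative_within_integral _ _ _ _ (fun z => beta z * expR (z ^+ 2))).
- exact: integrable_source_expR.
- by rewrite /= in_itv/= !ltW//; case/andP : xv.
- by apply: cvgM; apply: cvg_within_filter => //; exact: continuous_expR_sqr.
Qed.

End slope_equation.

Lemma is_derive_derive1 (R : realType) (f : R -> R) (x l : R) :
  is_derive x 1 f l -> derivable f x 1 /\ derive1 f x = l.
Proof. by move=> fl; split=> //; rewrite derive1E derive_val. Qed.

(** * Similarity solutions *)

Lemma is_derive_div (R : realType) (c x : R) :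
  is_derive x 1 (fun z => z / c) c^-1.
Proof.
apply/is_derive1_caratheodory; exists (fun=> c^-1); split=> //.
- by move=> z /=; ring.
- exact: cvg_cst.
Qed.

Lemma is_derive_comp_div (R : realType) (f : R -> R) (c K k d x : R) :
  is_derive (x / c) 1 f d ->
  is_derive x 1 (fun z => K * f (z / c) + k) (K * (d * c^-1)).
Proof.
move=> fd; have divc := is_derive_div c x.
have fx : is_derive x 1 (fun z => f (z / c)) (d * c^-1).
  exact: (@is_derive1_comp _ f (fun z => z / c)).
by apply: is_derive_eq; rewrite /GRing.scale/= addr0.
Qed.

(** * Derivatives of a function in similarity form *)

Section similarity_form.
Context {R : realType}.
Variables (theta0 thetaf a lambda t : R) (y dy : R -> R).
Variables (theta : R -> R -> R) (s : R -> R).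
Hypotheses (thetaf_lt : thetaf < theta0) (a0 : 0 < a) (l0 : 0 < lambda)
  (t0 : 0 < t)
  (dyP : forall eta, `[0, lambda] eta ->
     has_derivative_within `[0, lambda] y eta (dy eta))
  (sim : similarity_form theta0 thetaf a lambda y theta s).
Implicit Types x : R.

Local Notation c := (2 * a * Num.sqrt t).

Let w0 : 0 < Num.sqrt t. Proof. by rewrite sqrtr_gt0. Qed.

Let c_gt0 : 0 < c. Proof. by rewrite !mulr_gt0. Qed.

Let t2E : 2 * t = 2 * Num.sqrt t ^+ 2.
Proof. by rewrite sqr_sqrtr// ltW. Qed.

Lemma similarity_front : s t = c * lambda.
Proof. by have [-> _] := sim t0; ring. Qed.

Lemma similarity_theta x : 0 <= x <= s t ->
  theta x t = (theta0 - thetaf) * y (x / c) + thetaf.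
Proof. by have [_] := sim t0; exact. Qed.

Lemma similarity_variable_itv x : 0 < x < s t -> 0 < x / c < lambda.
Proof.
rewrite similarity_front => /andP[x0 xs].
by rewrite divr_gt0//= ltr_pdivrMr// mulrC.
Qed.

Let is_derive_y x : 0 < x < s t -> is_derive (x / c) 1 y (dy (x / c)).
Proof.
move=> /similarity_variable_itv el.
apply: (derivative_within_itv_is_derive el); apply: dyP.
by rewrite /= in_itv/=; case/andP : el => /ltW-> /ltW->.
Qed.

Lemma similarity_is_derive_x x : 0 < x < s t ->
  is_derive x 1 (fun z => theta z t) ((theta0 - thetaf) * (dy (x / c) * c^-1)).
Proof.
move=> xs.
have := is_derive_comp_div (theta0 - thetaf) thetaf (is_derive_y xs).
apply: near_eq_is_derive; near=> z; rewrite similarity_theta//.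
apply/andP; split; apply: ltW; near: z.
- by apply: lt_nbhsr; case/andP : xs.
- by apply: lt_nbhsl; case/andP : xs.
Unshelve. all: by end_near. Qed.

Lemma similarity_is_derive_t x : 0 < x < s t -> is_derive t 1 (fun r => theta x r)
  ((theta0 - thetaf) * (dy (x / c) * (- (x / c / (2 * t))))).
Proof.
move=> xs; pose f r := x / (2 * a * Num.sqrt r).
have ft : is_derive t 1 f (- (x / c / (2 * t))).
  have st := is_derive1_sqrt t0.
  have gt : is_derive t 1 (fun r => 2 * a * Num.sqrt r)
      (2 * a * (2 * Num.sqrt t)^-1).
    exact: is_derive_eq.
  have cN0 : 2 * a * Num.sqrt t != 0 by rewrite gt_eqF.
  have gV := @is_deriveV _ (fun r => 2 * a * Num.sqrt r) _ _ _ cN0 gt.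
  apply: is_derive_eq; rewrite /GRing.scale/= t2E; field.
  by rewrite !gt_eqF.
have yt : is_derive t 1 (fun r => y (f r)) (dy (x / c) * - (x / c / (2 * t))).
  apply: (@is_derive1_comp _ y f) => //.
  exact: is_derive_y.
have : is_derive t 1 (fun r => (theta0 - thetaf) * y (f r) + thetaf)
    ((theta0 - thetaf) * (dy (x / c) * - (x / c / (2 * t)))).
  by apply: is_derive_eq; rewrite /GRing.scale/= addr0.
(* The similarity form describes [theta x r] only while [x <= s r]. As [x < s t], this persists for
   [r] near [t], being implied by a strict lower bound on the continuous [Num.sqrt r]. *)
have xl : x / (2 * a * lambda) < Num.sqrt t.
  rewrite ltr_pdivrMr ?mulr_gt0//.
  by case/andP : xs => _; rewrite similarity_front mulrAC mulrC.
have near_sqrt : \forall r \near t, x / (2 * a * lambda) < Num.sqrt r.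
  have := @sqrt_continuous R t; move=> /cvgr_gt; exact.
apply: near_eq_is_derive; near=> r.
have r0 : 0 < r by near: r; exact: lt_nbhsr.
have [sr ->//] := sim r0.
case/andP : xs => /ltW -> _ /=; rewrite sr.
have : x / (2 * a * lambda) < Num.sqrt r by near: r.
by rewrite ltr_pdivrMr ?mulr_gt0// => /ltW; rewrite mulrC.
Unshelve. all: by end_near. Qed.

Lemma similarity_thermal_coefficient w delta p x : 0 < x < s t ->
  thermal_coefficient w delta p theta0 thetaf (theta x t) =
  w * (1 + delta * y (x / c) `^ p).
Proof.
move=> /andP[/ltW x0 /ltW xs]; rewrite /thermal_coefficient similarity_theta ?x0//.
by rewrite addrK mulrAC divff ?mul1r// gt_eqF// subr_gt0.
Qed.

Lemma similarity_is_derive_front : is_derive t 1 s (a * lambda / Num.sqrt t).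
Proof.
have st := is_derive1_sqrt t0.
have : is_derive t 1 (fun r => 2 * a * lambda * Num.sqrt r)
    (a * lambda / Num.sqrt t).
  apply: is_derive_eq; rewrite /GRing.scale/=; field.
  by rewrite gt_eqF.
apply: near_eq_is_derive; near=> r.
have r0 : 0 < r by near: r; exact: lt_nbhsr.
by have [-> _] := sim r0.
Unshelve. all: by end_near. Qed.

Lemma similarity_derivative_within_front :
  has_derivative_within `[0, s t] (fun z => theta z t) (s t)
    ((theta0 - thetaf) * (dy lambda * c^-1)).
Proof.
have st0 : 0 < s t by rewrite similarity_front mulr_gt0.
have stc : s t / c = lambda by rewrite similarity_front mulrAC divff ?mul1r// gt_eqF.
have ys : has_derivative_within `[0, s t] (y \o (fun z => z / c)) (s t)
    (dy lambda * c^-1).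
  apply: (@derivative_within_comp _ _ `[0, lambda]).
  - by rewrite /= in_itv/= lexx ltW.
  - move=> z; rewrite /= !in_itv/= similarity_front => /andP[z0 zs].
    by rewrite divr_ge0 ?(ltW c_gt0)//= ler_pdivrMr// mulrC.
  - by apply: is_derive_derivative_within; exact: is_derive_div.
  - by rewrite stc; apply: dyP; rewrite /= in_itv/= lexx ltW.
have := derivative_withinD (derivative_withinMl (c := theta0 - thetaf) ys)
  (derivative_within_cst `[0, s t] thetaf (s t)).
rewrite addr0; apply: eq_derivative_within.
  by rewrite /= in_itv/= lexx ltW.
by move=> z; rewrite inE/= in_itv/= => zs; rewrite similarity_theta.
Qed.

End similarity_form.

(** * From the functional problem to the Stefan problem *)

Section stefan.
Context {R : realType}.
Local Notation mu := (@lebesgue_measure R).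
Variables (rho l k0 c0 delta p theta0 thetaf a Ste : R) (beta : R -> R).
Hypotheses (rho_gt0 : 0 < rho) (l_gt0 : 0 < l) (k0_gt0 : 0 < k0) (c0_gt0 : 0 < c0)
    (delta_gt0 : 0 < delta) (p_gt0 : 0 < p) (thetaf_lt : thetaf < theta0)
    (aE : a = Num.sqrt (k0 / (rho * c0)))
    (SteE : Ste = c0 * (theta0 - thetaf) / l)
    (beta_int0 : forall epsilon, 0 < epsilon ->
       mu.-integrable `]0, epsilon[ (EFin \o beta)).

Implicit Types x eta u v : R.

Let Delta0 : 0 < theta0 - thetaf. Proof. by rewrite subr_gt0. Qed.

Let Ste0 : 0 < Ste.
Proof. by rewrite SteE divr_gt0// mulr_gt0. Qed.

Let a0 : 0 < a.
Proof. by rewrite aE sqrtr_gt0 divr_gt0// mulr_gt0. Qed.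

Let k0E : k0 = a ^+ 2 * (rho * c0).
Proof.
rewrite aE sqr_sqrtr ?divfK ?gt_eqF ?mulr_gt0//.
by rewrite divr_ge0 ?mulr_ge0// ltW.
Qed.

Local Notation rhs := (profile_rhs delta p Ste beta).
Local Notation slope := (profile_slope Ste beta).
Local Notation Q := (source_integral beta).

Section from_profile.
Variables (lambda : R) (y : R -> R) (theta : R -> R -> R) (s : R -> R).
Hypotheses (fp : functional_problem delta p Ste beta lambda y)
  (sim : similarity_form theta0 thetaf a lambda y theta s) (s0 : s 0 = 0).

Let l0 : 0 < lambda. Proof. by case: fp => -[]. Qed.

Let y_ge0 eta : 0 <= eta <= lambda -> 0 <= y eta.
Proof. by case: fp => -[_ y0 _ _] _ _; exact: y0. Qed.

Let yE eta : 0 <= eta <= lambda -> kirchhoff delta p (y eta) = rhs lambda eta.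
Proof. by case: fp => _ _; exact. Qed.

Let dy eta := slope lambda eta / (1 + delta * y eta `^ p).

Let den0 eta : 0 < 1 + delta * y eta `^ p.
Proof. by rewrite ltr_wpDr// mulr_ge0 ?powR_ge0// ltW. Qed.

Let dyP eta : `[0, lambda] eta -> has_derivative_within `[0, lambda] y eta (dy eta).
Proof.
exact: (derivative_within_profile beta_int0 delta_gt0 p_gt0 Ste0 y_ge0 yE).
Qed.

Let y0 : y 0 = 1.
Proof.
have zl : (0 : R) <= 0 <= lambda by apply/andP; split=> //; exact: ltW.
apply: (kirchhoff_inj delta_gt0 p_gt0); [exact: y_ge0|exact: ler01|].
by rewrite yE// profile_rhs0 kirchhoff1.
Qed.

Let yl : y lambda = 0.
Proof.
have ll : 0 <= lambda <= lambda by rewrite lexx ltW.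
apply: (kirchhoff_inj delta_gt0 p_gt0); [exact: y_ge0|exact: lexx|].
rewrite yE// kirchhoff0; apply/(front_equationE beta_int0 _ _ _ (ltW l0)).
by case: fp.
Qed.

Section fixed_time.
Variable t : R.
Hypothesis t0 : 0 < t.

Let c := 2 * a * Num.sqrt t.

Let w0 : 0 < Num.sqrt t. Proof. by rewrite sqrtr_gt0. Qed.

Let c_gt0 : 0 < c. Proof. by rewrite !mulr_gt0. Qed.

Let t2E : 2 * t = 2 * Num.sqrt t ^+ 2.
Proof. by rewrite sqr_sqrtr// ltW. Qed.

Let stE : s t = c * lambda. Proof. exact: similarity_front t0 sim. Qed.

Let thetaE x : 0 <= x <= s t ->
  theta x t = (theta0 - thetaf) * y (x / c) + thetaf.
Proof. exact: similarity_theta t0 sim x. Qed.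

Let eta_itv x : 0 < x < s t -> 0 < x / c < lambda.
Proof. exact: (similarity_variable_itv a0 t0 sim). Qed.

Let thermalE w x : 0 < x < s t ->
  thermal_coefficient w delta p theta0 thetaf (theta x t) =
  w * (1 + delta * y (x / c) `^ p).
Proof. exact: (similarity_thermal_coefficient thetaf_lt t0 sim). Qed.

Let is_derive_theta_x x : 0 < x < s t ->
  is_derive x 1 (fun z => theta z t) ((theta0 - thetaf) * (dy (x / c) * c^-1)).
Proof. exact: (similarity_is_derive_x a0 t0 dyP sim). Qed.

Let is_derive_theta_t x : 0 < x < s t -> is_derive t 1 (fun r => theta x r)
  ((theta0 - thetaf) * (dy (x / c) * (- (x / c / (2 * t))))).
Proof. exact: (similarity_is_derive_t a0 l0 t0 dyP sim). Qed.

(** The factor [1 + delta y^p] of the conductivity cancels the denominator of [dy]. *)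
Let heat_fluxE x : 0 < x < s t ->
  heat_flux k0 delta p theta0 thetaf theta t x =
  k0 * (theta0 - thetaf) / c * slope lambda (x / c).
Proof.
move=> xs; rewrite /heat_flux thermalE//.
have [_ ->] := is_derive_derive1 (is_derive_theta_x xs).
rewrite /dy; field.
by rewrite !gt_eqF.
Qed.

Let heat_equation x : 0 < x < s t ->
  is_derive (x / c) 1 Q (beta (x / c) * expR ((x / c) ^+ 2)) ->
  heat_equation_at rho l k0 c0 delta p theta0 thetaf a beta theta x t.
Proof.
move=> xs Qx; pose K := k0 * (theta0 - thetaf) / c.
pose H := 4 / Ste * beta (x / c) - 2 * (x / c) * slope lambda (x / c).
have Fx : is_derive x 1 (heat_flux k0 delta p theta0 thetaf theta t)
    (K * (H * c^-1)).
  have := is_derive_comp_div K 0 (is_derive_profile_slope Ste lambda Qx).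
  apply: near_eq_is_derive; near=> z; rewrite addr0 heat_fluxE//.
  apply/andP; split; near: z.
  - by apply: lt_nbhsr; case/andP : xs.
  - by apply: lt_nbhsl; case/andP : xs.
split; first by case: (is_derive_derive1 Fx).
have [_ ->] := is_derive_derive1 Fx.
have [_ ->] := is_derive_derive1 (is_derive_theta_t xs).
rewrite thermalE// /K /H /dy k0E SteE.
rewrite -/c t2E -[in _ / t](sqr_sqrtr (ltW t0)).
have cE : Num.sqrt t = c / (2 * a) by rewrite /c; field; rewrite gt_eqF.
rewrite cE; field.
by rewrite !gt_eqF.
Unshelve. all: by end_near. Qed.

(** Increments of the flux are multiples of those of [slope] from [u / c] to [x / c]; dilating their
    integral back to [[u, x]] puts a second factor [1 / c] in the density. *)
Let heat_flux_abs_continuous u v : 0 < u -> u < v -> v < s t ->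
  abs_continuous_on u v (heat_flux k0 delta p theta0 thetaf theta t).
Proof.
move=> u0 uv vs; pose K := k0 * (theta0 - thetaf) / c.
pose h z := 4 / Ste * beta z - 2 * z * slope lambda z.
have vl : v / c <= lambda by rewrite ltW// ltr_pdivrMr// mulrC -stE.
have uc0 : 0 <= u / c by rewrite ltW// divr_gt0.
have hi : mu.-integrable `[u / c, v / c] (EFin \o h).
  by apply: integrable_itvS uc0 vl (integrable_slope_equation Ste beta_int0 (ltW l0)).
have [hci _] := Rintegral_scale c_gt0 hi.
exists (fun z => K / c * h (z / c)); split.
  rewrite (_ : _ \o _ = (fun z => (K / c)%:E * (h (z / c))%:E)%E)//.
  exact: integrableZl.
move=> x /andP[ux xv].
have hxi : mu.-integrable `[u / c, x / c] (EFin \o h).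
  apply: integrable_itvS (lexx _) _ hi.
  by rewrite ler_pM2r ?invr_gt0.
have [hcxi hE] := Rintegral_scale c_gt0 hxi.
rewrite !heat_fluxE ?u0 ?(lt_trans uv)// ?(lt_le_trans u0)// ?(le_lt_trans xv)//.
have uxc : u / c <= x / c by rewrite ler_pM2r ?invr_gt0.
have xcl : x / c <= lambda by apply: le_trans vl; rewrite ler_pM2r ?invr_gt0.
have SE := profile_slope_integral Ste beta_int0 uc0 uxc xcl.
have -> : \int[mu]_(z in `[u, x]) (K / c * h (z / c)) =
    K / c * \int[mu]_(z in `[u, x]) h (z / c) by exact: RintegralZl.
by rewrite hE -/K -SE; field; rewrite gt_eqF.
Qed.

Let ae_heat_equation : \forall x \ae mu, 0 < x < s t ->
  heat_equation_at rho l k0 c0 delta p theta0 thetaf a beta theta x t.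
Proof.
have aeF := ae_filter_ringOfSetsType mu.
have := ae_scale c_gt0 (ae_derivative_source_integral beta_int0 lambda).
by apply: filterS => x xQ xs; apply: heat_equation => //; exact/xQ/eta_itv.
Qed.

Let stefan_condition : exists2 thetax,
  has_derivative_within `[0, s t] (fun z => theta z t) (s t) thetax &
  k0 * thetax = - (rho * l * derive1 s t).
Proof.
have [_ ->] := is_derive_derive1 (similarity_is_derive_front t0 sim).
exists ((theta0 - thetaf) * (dy lambda * c^-1)).
  exact: (similarity_derivative_within_front a0 l0 t0 dyP sim).
(* As [y lambda = 0] and [p > 0], the denominator of [dy lambda] is 1; the source terms then cancel
   and [- 2 lambda / Ste] remains. *)
rewrite /dy yl powR0 ?gt_eqF// /profile_slope mulr0 addr0.
have E1 := expR_Nsqr_sqr lambda.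
have -> : 2 / Ste * expR (- lambda ^+ 2) *
    (2 * Q lambda - (2 * Q lambda + lambda * expR (lambda ^+ 2))) =
    - (2 / Ste * lambda * (expR (- lambda ^+ 2) * expR (lambda ^+ 2))) by ring.
rewrite E1 /c k0E SteE; field.
by rewrite !gt_eqF.
Qed.

Lemma stefan_solution_fixed_time :
    [/\ forall x, 0 < x < s t ->
          derivable (fun z => theta z t) x 1 /\
          derivable (fun r => theta x r) t 1,
        (forall x, 0 < x < s t ->
          {for x / (2 * a * Num.sqrt t), continuous beta} ->
          heat_equation_at rho l k0 c0 delta p theta0 thetaf a beta theta x t)
        /\
        (\forall x \ae lebesgue_measure, 0 < x < s t ->
          heat_equation_at rho l k0 c0 delta p theta0 thetaf a beta theta x t)
        /\
        (forall u v, 0 < u -> u < v -> v < s t ->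
          abs_continuous_on u v
            (heat_flux k0 delta p theta0 thetaf theta t)),
        theta 0 t = theta0 /\ theta (s t) t = thetaf &
        derivable s t 1 /\
        exists2 thetax : R,
          has_derivative_within `[0, s t] (fun z => theta z t) (s t) thetax &
          k0 * thetax = - (rho * l * derive1 s t)].
Proof.
have st0 : 0 < s t by rewrite stE mulr_gt0.
split.
- move=> x xs; split; first by case: (is_derive_theta_x xs).
  by case: (is_derive_theta_t xs).
- split; last by split; [exact: ae_heat_equation|exact: heat_flux_abs_continuous].
  move=> x xs bx; apply: heat_equation => //.
  by apply: derivative_source_integral => //; case/andP : (eta_itv xs).
- split; first by rewrite thetaE ?lexx ?ltW// mul0r y0 mulr1 subrK.
  rewrite thetaE ?lexx ?ltW// stE mulrAC divff ?mul1r ?gt_eqF// yl.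
  by rewrite mulr0 add0r.
- split; last exact: stefan_condition.
  by case: (similarity_is_derive_front t0 sim).
Qed.

End fixed_time.

Lemma similarity_solution_of_profile :
  similarity_solution rho l k0 c0 delta p theta0 thetaf a beta theta s.
Proof.
split; first by split=> // t t0; exact: stefan_solution_fixed_time.
by exists lambda, y; split=> //; case: fp.
Qed.

End from_profile.
End stefan.

(** * From a similarity solution to the functional problem *)

Section converse.
Context {R : realType}.
Local Notation mu := (@lebesgue_measure R).
Variables (rho l k0 c0 delta p theta0 thetaf a Ste : R) (beta : R -> R).
Hypotheses (rho_gt0 : 0 < rho) (l_gt0 : 0 < l) (k0_gt0 : 0 < k0) (c0_gt0 : 0 < c0)
    (p_gt0 : 0 < p) (thetaf_lt : thetaf < theta0)
    (aE : a = Num.sqrt (k0 / (rho * c0)))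
    (SteE : Ste = c0 * (theta0 - thetaf) / l)
    (beta_int0 : forall epsilon, 0 < epsilon ->
       mu.-integrable `]0, epsilon[ (EFin \o beta)).
Implicit Types x eta u v : R.

Let Delta0 : 0 < theta0 - thetaf. Proof. by rewrite subr_gt0. Qed.

Let Ste0 : 0 < Ste.
Proof. by rewrite SteE divr_gt0// mulr_gt0. Qed.

Let a0 : 0 < a.
Proof. by rewrite aE sqrtr_gt0 divr_gt0// mulr_gt0. Qed.

Let k0E : k0 = a ^+ 2 * (rho * c0).
Proof.
rewrite aE sqr_sqrtr ?divfK ?gt_eqF ?mulr_gt0//.
by rewrite divr_ge0 ?mulr_ge0// ltW.
Qed.

Local Notation rhs := (profile_rhs delta p Ste beta).
Local Notation slope := (profile_slope Ste beta).
Local Notation Q := (source_integral beta).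

Variables (lambda : R) (y : R -> R) (theta : R -> R -> R) (s : R -> R).
Hypotheses
  (sol : stefan_solution rho l k0 c0 delta p theta0 thetaf a beta theta s)
  (adm : admissible_profile p beta lambda y)
  (sim : similarity_form theta0 thetaf a lambda y theta s).

Let l0 : 0 < lambda. Proof. by case: adm. Qed.

Let y_ge0 eta : 0 <= eta <= lambda -> 0 <= y eta.
Proof. by case: adm => _ + _ _; exact. Qed.

(* The time at which the similarity variable is x itself. *)
Let t := (2 * a) ^- 2.

Let t0 : 0 < t. Proof. by rewrite invr_gt0 exprn_gt0// mulr_gt0. Qed.

Let sqrt_t : Num.sqrt t = (2 * a)^-1.
Proof. by rewrite /t -exprVn sqrtr_sqr ger0_norm// invr_ge0 mulr_ge0// ltW. Qed.

Let cE : 2 * a * Num.sqrt t = 1.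
Proof. by rewrite sqrt_t divff// gt_eqF// mulr_gt0. Qed.

Let stE : s t = lambda.
Proof. by rewrite (similarity_front t0 sim) cE mul1r. Qed.

Let thetaE x : 0 <= x <= lambda -> theta x t = (theta0 - thetaf) * y x + thetaf.
Proof. by rewrite -stE => /(similarity_theta t0 sim); rewrite cE divr1. Qed.

Let y_theta x : 0 <= x <= lambda -> y x = (theta x t - thetaf) / (theta0 - thetaf).
Proof. by move=> /thetaE ->; field; rewrite gt_eqF. Qed.

Let y0 : y 0 = 1.
Proof.
have [_ /(_ t t0)[_ _ [+ _] _]] := sol; rewrite y_theta ?lexx ?ltW// => ->.
by rewrite divff// gt_eqF.
Qed.

Let yl : y lambda = 0.
Proof.
have [_ /(_ t t0)[_ _ [_ +] _]] := sol.
by rewrite y_theta ?lexx ?ltW// stE => ->; rewrite subrr mul0r.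
Qed.

Section with_derivative.
Variable dy : R -> R.
Hypotheses (dyP : forall eta, `[0, lambda] eta ->
     has_derivative_within `[0, lambda] y eta (dy eta))
  (dyc : {within `[0, lambda], continuous dy}).

(** The derivative of [kirchhoff delta p \o y], to be identified with [slope lambda]. *)
Let H x := (1 + delta * y x `^ p) * dy x.

Let Hc : {within `[0, lambda], continuous H}.
Proof.
apply/subspace_continuousP => x xl; apply: cvgM; last first.
  by move/subspace_continuousP : dyc; exact.
apply: cvgD; first exact: cvg_cst.
apply: cvgM; first exact: cvg_cst.
have yx0 : 0 <= y x by apply: y_ge0; move: xl; rewrite /= in_itv.
apply: (cvg_within_comp (E := `[0, +oo[) _ (derivative_within_cvg (dyP xl))
  (cvg_within_powR p_gt0 yx0)).
by move=> z; rewrite /= !in_itv/= andbT; exact: y_ge0.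
Qed.

(** The Stefan condition speaks of some one-sided derivative [thetax] at the front; by uniqueness on
    a nondegenerate segment it is the one computed from [dy]. *)
Let dy_lambda : dy lambda = - (2 * lambda) / Ste.
Proof.
have [_ /(_ t t0)[_ _ _ [_ [thetax thetaxP thetaxE]]]] := sol.
have thetaxP' := similarity_derivative_within_front a0 l0 t0 dyP sim.
have st0 : 0 < s t by rewrite stE.
have stst : `[0, s t] (s t) by rewrite /= in_itv/= lexx ltW.
move: thetaxE; rewrite (derivative_within_itv_unique st0 stst thetaxP thetaxP').
have [_ ->] := is_derive_derive1 (similarity_is_derive_front t0 sim).
rewrite cE sqrt_t invr1 mulr1 k0E => E.
apply: (mulfI (x := a ^+ 2 * (rho * c0) * (theta0 - thetaf))).
  by rewrite gt_eqF// !mulr_gt0// exprn_gt0.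
rewrite -[LHS]mulrA E SteE; field.
by rewrite !gt_eqF.
Qed.

Let heat_fluxE x : 0 < x < lambda ->
  heat_flux k0 delta p theta0 thetaf theta t x = k0 * (theta0 - thetaf) * H x.
Proof.
rewrite -stE => xs; rewrite /heat_flux (similarity_thermal_coefficient thetaf_lt t0 sim)//.
have [_ ->] := is_derive_derive1 (similarity_is_derive_x a0 t0 dyP sim xs).
by rewrite cE divr1 invr1 mulr1 /H; ring.
Qed.

Let heat_equationE x D : 0 < x < lambda ->
  is_derive x 1 (heat_flux k0 delta p theta0 thetaf theta t) D ->
  heat_equation_at rho l k0 c0 delta p theta0 thetaf a beta theta x t ->
  D = k0 * (theta0 - thetaf) * (4 / Ste * beta x - 2 * x * H x).
Proof.
rewrite -stE => xs Fx [_]; have [_ ->] := is_derive_derive1 Fx.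
have [_ ->] := is_derive_derive1 (similarity_is_derive_t a0 l0 t0 dyP sim xs).
rewrite (similarity_thermal_coefficient thetaf_lt t0 sim)//.
rewrite cE divr1 => /esym/(canRL (subrK _)) ->.
rewrite /H k0E SteE /t; field.
by rewrite !gt_eqF.
Qed.

Let h z := 4 / Ste * beta z - 2 * z * H z.

Let integrable_h u v : 0 <= u -> v <= lambda ->
  mu.-integrable `[u, v] (EFin \o h).
Proof.
move=> u0 vl; rewrite (_ : _ \o _ = (fun x => (4 / Ste)%:E * (beta x)%:E -
  (2 * x * H x)%:E)%E)//.
apply: integrableB => //.
  apply: integrableZl => //.
  by apply: integrable_itvS (integrable_source beta_int0 v).
apply: (@integrable_continuous_itv _ _ _ (fun x => 2 * x * H x)).
have uvl : `[u, v] `<=` `[0, lambda] by apply: subset_itv; rewrite bnd_simp.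
apply: (continuous_subspaceW uvl); apply/subspace_continuousP => z zl.
apply: cvgM; last by move/subspace_continuousP : Hc; exact.
by apply: cvgM; [exact: cvg_cst|apply: cvg_within_filter; exact: cvg_id].
Qed.

(** The flux is the integral of some density [g]. By Lebesgue differentiation [g] is its derivative
    almost everywhere, and the heat equation identifies it there with [K * h]. Both ends stay inside
    []0, lambda[], where absolute continuity of the flux is granted. *)
Let H_integral u v : 0 < u -> u < v -> v < lambda ->
  forall x, `[u, v] x ->
  H x - H u = \int[mu]_(z in `[u, x]) h z.
Proof.
move=> u0 uv vl x xuv; have [ux xv] : u <= x /\ x <= v.
  by move: xuv; rewrite /= in_itv/= => /andP[].
pose K := k0 * (theta0 - thetaf).
have K0 : 0 < K by rewrite mulr_gt0.
have [_ /(_ t t0)[_ [_ [heat flux_ac]] _ _]] := sol.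
have [|g [gi gE]] := flux_ac u v u0 uv; first by rewrite stE.
have uvl : 0 <= u /\ v <= lambda by split; exact: ltW.
have hi := integrable_h uvl.1 uvl.2.
have Khi : mu.-integrable `[u, v] (EFin \o (fun z => K * h z)).
  rewrite (_ : _ \o _ = (fun z => K%:E * (h z)%:E)%E)//.
  exact: integrableZl.
have gh : \forall z \ae mu, u < z < v -> g z = K * h z.
  have aeF := ae_filter_ringOfSetsType mu.
  apply: filterS (filterI heat (ae_derivative_integral gi)) => z [zh zg] zuv.
  have zl : 0 < z < lambda.
    by case/andP : zuv => uz zv; rewrite (lt_trans u0 uz) (lt_trans zv vl).
  apply: (heat_equationE zl); last by apply: zh; rewrite stE.
  have : is_derive z 1 (fun w => \int[mu]_(x in `[u, w]) g x +
      heat_flux k0 delta p theta0 thetaf theta t u) (g z).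
    have := zg zuv => gz.
    by apply: is_derive_eq; rewrite addr0.
  apply: near_eq_is_derive; near=> w.
  rewrite -gE ?subrK//; apply/andP; split; apply: ltW; near: w.
  - by apply: lt_nbhsr; case/andP : zuv.
  - by apply: lt_nbhsl; case/andP : zuv.
apply: (mulfI (x := K)); first by rewrite gt_eqF.
have ul : 0 < u < lambda by rewrite u0 (lt_trans uv vl).
have xl : 0 < x < lambda by rewrite (lt_le_trans u0 ux) (le_lt_trans xv vl).
rewrite mulrBr -!heat_fluxE// gE ?ux ?xv//.
have gix : mu.-integrable `[u, x] (EFin \o g) by exact: integrable_itvS gi.
have hix : mu.-integrable `[u, x] (EFin \o h) by exact: integrable_itvS hi.
have Khix : mu.-integrable `[u, x] (EFin \o (fun z => K * h z)).
  exact: integrable_itvS Khi.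
rewrite (ae_eq_Rintegral_itv gix Khix); first exact: RintegralZl.
have aeF := ae_filter_ringOfSetsType mu.
apply: filterS gh => z + /andP[uz zx]; apply.
by rewrite uz (lt_le_trans zx xv).
Unshelve. all: by end_near. Qed.

Let W x := expR (x ^+ 2) * H x - 4 / Ste * Q x.

(* e^(x^2) is the integrating factor of H' + 2 x H = 4 beta / Ste. *)
Let W_cst u v : 0 < u -> u < v -> v < lambda -> W v = W u.
Proof.
move=> u0 uv vl; have uv' := ltW uv.
pose E z : R := expR (z ^+ 2); pose e z : R := 2 * z * expR (z ^+ 2).
have Ee z : `[u, v] z -> has_derivative_within `[u, v] E z (e z).
  by move=> _; apply: is_derive_derivative_within; exact: is_derive_expR_sqr.
have ec : {within `[u, v], continuous e}.
  apply: continuous_subspaceT => z; apply: cvgM; last exact: continuous_expR_sqr.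
  by apply: cvgM; [exact: cvg_cst|exact: cvg_id].
have vv : `[u, v] v by rewrite /= in_itv/= lexx ltW.
have hi := integrable_h (ltW u0) (ltW vl).
have := integration_by_parts_integrable hi Ee ec vv.
rewrite -(H_integral u0 uv vl vv).
pose q z := beta z * expR (z ^+ 2).
have qi : mu.-integrable `[0, v] (EFin \o q) by exact: integrable_source_expR.
have quvi : mu.-integrable `[u, v] (EFin \o q).
  by apply: integrable_itvS qi; [exact: ltW|].
have ei : mu.-integrable `[u, v] (EFin \o e) by exact: integrable_continuous_itv.
(* The inner integral is [H z - H u], and [e z * H z] cancels the term of [h z * E z] that contains
   [H z], so the unknown leaves the integrand. *)
have -> : \int[mu]_(z in `[u, v]) (h z * E z + e z * \int[mu]_(w in `[u, z]) h w)
    = \int[mu]_(z in `[u, v]) (4 / Ste * q z - H u * e z).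
  apply: eq_Rintegral => z; rewrite inE => zuv.
  by rewrite -(H_integral u0 uv vl zuv) /h /q /E /e; ring.
have -> : \int[mu]_(z in `[u, v]) (4 / Ste * q z - H u * e z) =
    4 / Ste * (Q v - Q u) - H u * (E v - E u).
  rewrite RintegralB//; last 2 first.
  - rewrite (_ : _ \o _ = (fun z => (4 / Ste)%:E * (q z)%:E)%E)//.
    exact: integrableZl.
  - rewrite (_ : _ \o _ = (fun z => (H u)%:E * (e z)%:E)%E)//.
    exact: integrableZl.
  rewrite !RintegralZl// (Rintegral_derivative Ee ec vv).
  congr (_ * _ - _); rewrite /source_integral (Rintegral_chasles (ltW u0) uv' qi).
  by rewrite addrAC subrr add0r.
rewrite /W -/(E v) -/(E u) => EH; apply/eqP; rewrite -subr_eq0; apply/eqP.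
have -> : E v * H v - 4 / Ste * Q v - (E u * H u - 4 / Ste * Q u) =
  E v * (H v - H u) - (4 / Ste * (Q v - Q u) - H u * (E v - E u)) by ring.
by rewrite EH subrr.
Qed.

(** Continuity of [H] up to the ends, due to [y] being of class C^1, extends the constancy of [W] to
    [[0, lambda]]; its value is read at [lambda] from the Stefan condition and [y lambda = 0]. *)
Let H_slope x : `[0, lambda] x -> H x = slope lambda x.
Proof.
move=> xl; have Wc : {within `[0, lambda], continuous W}.
  apply/subspace_continuousP => z zl; apply: cvgB.
    apply: cvgM; last by move/subspace_continuousP : Hc; exact.
    by apply: cvg_within_filter; exact: continuous_expR_sqr.
  apply: cvgM; first exact: cvg_cst.
  have /subspace_continuousP := continuous_source_integral beta_int0 (ltW l0).
  exact.
have WE : W x = W lambda by exact: cst_within_itv Wc W_cst x xl.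
have HE : H x = expR (- x ^+ 2) * (W x + 4 / Ste * Q x).
  by rewrite /W subrK mulrA expR_Nsqr_sqr mul1r.
rewrite HE WE /W /H yl powR0 ?gt_eqF// dy_lambda /profile_slope; field.
by rewrite gt_eqF.
Qed.

Let kirchhoff_y x : `[0, lambda] x -> kirchhoff delta p (y x) = rhs lambda x.
Proof.
apply: (@derivative_within_eq_itv _ _ _ (kirchhoff delta p \o y) _ H) => [z zl|z zl|].
- apply: (@derivative_within_comp _ _ `[0, +oo[) => //; last 2 first.
  + exact: dyP.
  + apply: derivative_within_kirchhoff => //.
    by apply: y_ge0; move: zl; rewrite /= in_itv.
  by move=> w; rewrite /= !in_itv/= andbT; exact: y_ge0.
- by rewrite H_slope//; exact: derivative_within_profile_rhs.
- by rewrite /= y0 kirchhoff1 profile_rhs0.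
Qed.

Lemma functional_problem_of_derivative : functional_problem delta p Ste beta lambda y.
Proof.
split; [exact: adm| |move=> eta etal]; last first.
  by apply: kirchhoff_y; rewrite /= in_itv.
apply/(front_equationE beta_int0 _ _ _ (ltW l0)).
by rewrite -kirchhoff_y ?yl ?kirchhoff0//= in_itv/= lexx ltW.
Qed.

End with_derivative.

Lemma functional_problem_of_similarity_solution :
  functional_problem delta p Ste beta lambda y.
Proof.
have [_ _ [dy [dyP dyc]] _] := adm.
exact: functional_problem_of_derivative dyP dyc.
Qed.

End converse.

Unset Implicit Arguments.
Set Strict Implicit.
Set Printing Implicit Defensive.

Theorem theorem2p3 (R : realType)
    (rho l k0 c0 delta p theta0 thetaf a Ste : R) (beta : R -> R)
    (rho_gt0 : 0 < rho) (l_gt0 : 0 < l) (k0_gt0 : 0 < k0) (c0_gt0 : 0 < c0)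
    (delta_gt0 : 0 < delta) (p_gt0 : 0 < p)
    (theta0_gt0 : 0 < theta0) (thetaf_lt : thetaf < theta0)
    (aE : a = Num.sqrt (k0 / (rho * c0)))
    (SteE : Ste = c0 * (theta0 - thetaf) / l)
    (beta_ge0 : forall eta, 0 < eta -> 0 <= beta eta)
    (beta_int0 : forall epsilon, 0 < epsilon ->
       lebesgue_measure.-integrable `]0, epsilon[ (EFin \o beta))
    (beta_intoo : forall M, 0 < M ->
       lebesgue_measure.-integrable `]M, +oo[
         (EFin \o (fun eta => beta eta * expR (eta ^+ 2)))) :
  exists (lambda : R) (y : R -> R),
    [/\ functional_problem delta p Ste beta lambda y,
        (forall (lambda' : R) (y' : R -> R),
           functional_problem delta p Ste beta lambda' y' ->
           lambda' = lambda /\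
           (forall eta, 0 <= eta <= lambda -> y' eta = y eta)),
        (exists (theta : R -> R -> R) (s : R -> R),
           similarity_solution rho l k0 c0 delta p theta0 thetaf a beta
             theta s) &
        (forall (theta : R -> R -> R) (s : R -> R),
           similarity_solution rho l k0 c0 delta p theta0 thetaf a beta
             theta s <->
           s 0 = 0 /\ similarity_form theta0 thetaf a lambda y theta s)].
Proof.
have Ste0 : 0 < Ste by rewrite SteE divr_gt0// mulr_gt0// subr_gt0.
have [lambda [y fp]] :=
  functional_problem_exists beta_ge0 beta_int0 delta_gt0 p_gt0 Ste0.
have uniq := functional_problem_unique beta_ge0 beta_int0 delta_gt0 p_gt0 Ste0 fp.
have of_form theta s : s 0 = 0 ->
    similarity_form theta0 thetaf a lambda y theta s ->
    similarity_solution rho l k0 c0 delta p theta0 thetaf a beta theta s.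
  move=> s0 sim; exact: (similarity_solution_of_profile rho_gt0 l_gt0 k0_gt0
    c0_gt0 delta_gt0 p_gt0 thetaf_lt aE SteE beta_int0 fp sim s0).
have a0 : 0 < a by rewrite aE sqrtr_gt0 divr_gt0// mulr_gt0.
exists lambda, y; split=> //.
  (* The formulas may serve for all [x] and [t]: [theta] is constrained only for [0 <= x <= s t]
     with [t > 0], and [s 0 = 0] because the root vanishes at 0. *)
  exists (fun x t =>
    (theta0 - thetaf) * y (x / (2 * a * Num.sqrt t)) + thetaf).
  exists (fun t => 2 * a * lambda * Num.sqrt t).
  by apply: of_form => //; rewrite sqrtr0 mulr0.
move=> theta s; split=> [[sol [lambda' [y' [adm sim]]]]|[s0 sim]]; last first.
  exact: of_form.
split; first by case: sol.
have fp' := functional_problem_of_similarity_solution rho_gt0 l_gt0 k0_gt0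
  c0_gt0 p_gt0 thetaf_lt aE SteE beta_int0 sol adm sim.
(* The solution may come with another profile [y']. It agrees with [y] on [[0, lambda]], which
   contains every value of [x / (2 * a * Num.sqrt t)] that occurs. *)
have [ll yy] := uniq _ _ fp'; subst lambda' => t t0.
have [st thetaE] := sim t t0; split=> // x xs; rewrite thetaE//; congr (_ * _ + _).
apply: yy; move: xs; rewrite st => /andP[x0 xs].
have c0' : 0 < 2 * a * Num.sqrt t by rewrite !mulr_gt0 ?sqrtr_gt0.
by rewrite divr_ge0 ?(ltW c0')//= ler_pdivrMr// (le_trans xs)// mulrAC mulrC.
Qed.
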